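(* \textsc{Ranged-Foremost-path TGR} can be solved in $\mathcal{O}(k^2 3^k n^4)$ time and $\mathcal{O}(2^k+n^2)$ space, where $k$ is the number of undetermined entries of the input matrix $D$.
   Context: A temporal graph $\mathcal{G}=(G,\lambda)$ consists of a static undirected graph $G=(V,E)$ with $V=[n]$ and $\lambda:E\to 2^{\mathbb{N}_{>0}}$ assigning to each edge the set of positive times at which it appears. A strict temporal $uv$-path is a path $u=v_0,\dots,v_k=v$ in $G$ with distinct vertices and times $\tau_1<\dots<\tau_k$, $\tau_i\in\lambda(\{v_{i-1},v_i\})$; its arrival time is $\tau_k$. $\mathrm{Fo}(\mathcal{G})$ is the $n\times n$ matrix with diagonal $0$ and entry $(u,v)$, $u\neq v$, the minimum arrival time of a strict temporal $uv$-path ($\infty$ if none). \textsc{Ranged-Foremost-path TGR}: given $n$ and an $n\times n$ matrix $D$ whose entries are integer ranges $D_{uv}=[\ell_{uv},r_{uv}]=\{\ell_{uv},\dots,r_{uv}\}$, decide whether there is a temporal graph $\mathcal{G}$ on $[n]$ with $\mathrm{Fo}(\mathcal{G})_{uv}\in D_{uv}$ for all $u,v\in[n]$. An entry $(u,v)$ is undetermined if $\ell_{uv}\neq r_{uv}$. *)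

(* Defs.v *)
From mathcomp Require Import all_boot all_order all_algebra.
From mathcomp Require Import boolp.

Set Implicit Arguments.
Unset Strict Implicit.
Unset Printing Implicit Defensive.

(* The vertex set [n] is 'I_n.  The labelling [lam] is only meaningful on
   [edges]; its values elsewhere are never used. *)
Record temporal_graph (n : nat) := TemporalGraph {
  edges : {set {set 'I_n}};
  lam : {set 'I_n} -> nat -> Prop;
  edges_pair : forall e, e \in edges -> #|e| = 2;
  lam_pos : forall e t, e \in edges -> lam e t -> 0 < t
}.

(* A path u = v_0, ..., v_k with times t_1, ..., t_k is given by its start u
   and the sequence of pairs (v_1, t_1), ..., (v_k, t_k). *)
Fixpoint follows n (G : temporal_graph n) (u : 'I_n) (s : seq ('I_n * nat))
    : Prop :=
  if s is (w, t) :: s' then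
    [/\ [set u; w] \in edges G, lam G [set u; w] t & follows G w s']
  else True.

Definition strict_temporal_path n (G : temporal_graph n) (u v : 'I_n)
    (s : seq ('I_n * nat)) : Prop :=
  [/\ follows G u s, uniq (u :: unzip1 s), sorted ltn (unzip2 s)
    & last u (unzip1 s) = v].

Definition arrival (n : nat) (s : seq ('I_n * nat)) : nat := last 0 (unzip2 s).

Definition arrives_at n (G : temporal_graph n) (u v : 'I_n) (t : nat) : Prop :=
  exists2 s, strict_temporal_path G u v s & arrival s = t.

(* [None] stands for infinity. *)
Definition Fo n (G : temporal_graph n) : 'M[option nat]_n :=
  \matrix_(u, v)
    if u == v then Some 0
    else if pselect (exists t, `[< arrives_at G u v t >]) is left ex_t
    then Some (ex_minn ex_t) else None.

Definition in_range (d : int * int) (x : option nat) : bool :=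
  if x is Some t then ((d.1 <= Posz t) && (Posz t <= d.2))%R else false.

Definition Ranged_Foremost_TGR n (D : 'M[int * int]_n) : Prop :=
  exists G : temporal_graph n, forall u v, in_range (D u v) (Fo G u v).

Definition num_undetermined n (D : 'M[int * int]_n) : nat :=
  #|[set p : 'I_n * 'I_n | (D p.1 p.2).1 != (D p.1 p.2).2]|.

Definition magnitude n (D : 'M[int * int]_n) : nat :=
  \max_(u < n) \max_(v < n) maxn `|(D u v).1|%N `|(D u v).2|%N.

(* Unit-cost random access machine on integer words, with registers R and
   memory M; [l] is an absolute position in the program.  A program mentions
   only finitely many registers, so these are O(1) words. *)
Inductive instr : Type :=
  | Const (d : nat) (z : int)     (* R[d] := z *)
  | Add (d a b : nat)             (* R[d] := R[a] + R[b] *)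
  | Sub (d a b : nat)
  | Mul (d a b : nat)
  | Div (d a b : nat)             (* Euclidean quotient, 0 if R[b] = 0 *)
  | Fetch (d a : nat)             (* R[d] := M[R[a]] *)
  | Store (a b : nat)             (* M[R[a]] := R[b] *)
  | Jump (l : nat)
  | JumpLe (a b l : nat)          (* goto l if R[a] <= R[b] *)
  | Halt.

Definition program : Type := seq instr.

Record config : Type := Config {
  pc : nat;
  reg : nat -> int;
  mem : nat -> int
}.

Definition upd (f : nat -> int) (d : nat) (z : int) : nat -> int :=
  fun x => if x == d then z else f x.

Definition set_reg (c : config) (d : nat) (z : int) : config :=
  Config (pc c).+1 (upd (reg c) d z) (mem c).

(* [None]: the machine has halted, or is stuck on a negative address or a
   position outside the program. *)
Definition step (P : program) (c : config) : option config :=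
  let R := reg c in
  match onth P (pc c) with
  | Some (Const d z) => Some (set_reg c d z)
  | Some (Add d a b) => Some (set_reg c d (R a + R b)%R)
  | Some (Sub d a b) => Some (set_reg c d (R a - R b)%R)
  | Some (Mul d a b) => Some (set_reg c d (R a * R b)%R)
  | Some (Div d a b) => Some (set_reg c d (R a %/ R b)%Z)
  | Some (Fetch d a) =>
      if R a is Posz i then Some (set_reg c d (mem c i)) else None
  | Some (Store a b) =>
      if R a is Posz i then Some (Config (pc c).+1 R (upd (mem c) i (R b)))
      else None
  | Some (Jump l) => Some (Config l R (mem c))
  | Some (JumpLe a b l) =>
      Some (Config (if (R a <= R b)%R then l else (pc c).+1) R (mem c))
  | Some Halt | None => None
  end.

Definition run (P : program) (t : nat) (c : config) : option config :=
  iter t (obind (step P)) (Some c).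

Definition halted (P : program) (c : config) : Prop :=
  onth P (pc c) = Some Halt.

Definition accesses (P : program) (c : config) (i : nat) : Prop :=
  match onth P (pc c) with
  | Some (Fetch _ a) | Some (Store a _) => reg c a = Posz i
  | _ => False
  end.

Definition words_bounded (W : nat) (c : config) : Prop :=
  forall i, (`|reg c i|%N <= W) /\ (`|mem c i|%N <= W).

(* Register 0 holds n; the endpoints of D_uv are, in row-major order, at
   addresses 2(un + v) and 2(un + v) + 1; everything else is 0. *)
Definition input_words n (D : 'M[int * int]_n) : seq int :=
  flatten [seq [:: (D u v).1; (D u v).2] | u <- enum 'I_n, v <- enum 'I_n].

Definition init n (D : 'M[int * int]_n) : config :=
  Config 0 (fun r => if r == 0 then Posz n else 0%R)
    (fun i => nth 0%R (input_words D) i).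

(* On input D the program P halts after at most T steps with the answer in
   register 0, accesses only memory addresses below S (the input included),
   and never holds a word of absolute value above W.  The bound W makes the
   unit-cost measure and the counting of space in words meaningful. *)
Definition decides_within (P : program) (T S W : nat) n (D : 'M[int * int]_n)
    : Prop :=
  exists t c,
    [/\ t <= T,
        run P t (init D) = Some c,
        halted P c,
        reg c 0 = (if `[< Ranged_Foremost_TGR D >] then 1%R else 0%R)
      & forall i c', i <= t -> run P i (init D) = Some c' ->
          (forall a, accesses P c' a -> a < S) /\ words_bounded W c'].

(* Main.v *)
Require Import Defs.
From mathcomp Require Import all_boot all_order all_algebra.
From mathcomp Require Import boolp.
From mathcomp Require Import zify.

Import Defs GRing.Theory.

Set Implicit Arguments.
Unset Strict Implicit.
Unset Printing Implicit Defensive.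

(* A matrix [A] with zero diagonal and positive other entries is a matrix of
   foremost arrival times iff every entry [A w v = t] is supported: some [u]
   has [A w u < t], and the edge [uv] may appear at time [t] without making any
   vertex reach [u] or [v] earlier than [A] says.  Support at time [t] depends
   only on which entries are smaller than, equal to, or larger than [t].

   Hence one can sweep over time, remembering which undetermined entries are
   already reached: a round at time [t] ranges over the [3 ^ k] ways to split
   the undetermined entries into old, new and later ones, and checks the support
   of the new entries, at cost [O(n ^ 2)] each.  A realization of minimal sum
   takes only values [l + j], with [l] a lower bound and [j <= k], so there are
   at most [n ^ 2 (k + 1)] rounds.  Every determined entry is new in one round
   only and at most [k] undetermined ones are new in a round, which gives the
   total time [O(k ^ 2 3 ^ k n ^ 4)]; two tables of [2 ^ k] bits suffice.

   The algorithm is written in a structured language with a clock, verified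
   with weakest preconditions, and compiled to the random access machine. *)

(** A mask of the entries already reached is enough memory although it forgets their values: the
    support of a new entry asks only which entries are smaller, equal or larger, so any partial
    matrix with the same mask can serve as the past.

    The space bound forbids storing the [n ^ 2 (k + 1)] candidate times. Each round finds the next
    one by a scan over all lower bounds and all offsets up to [k]; the scans cost [O(k ^ 2 n ^ 4)]
    in total, within the time bound.

    The machine has signed words, while the program is verified over natural numbers. A shift of
    memory words by one reconciles the two, since a negative endpoint matters only through being
    smaller than every time.

    All expressions of the program have bounded size. Hence one tick of the clock pays for a
    constant number of instructions, and every intermediate value is at most a fixed power of the
    bound on the values assigned or stored, which gives the bound on words. *)

Inductive expr : Type :=
  | Var (x : nat)
  | Cst (z : nat)
  | EAdd (a b : expr)
  | ESub (a b : expr)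
  | EMul (a b : expr)
  | EDiv (a b : expr)
  | ELd (a : expr).

Inductive cmd : Type :=
  | Asg (x : nat) (e : expr)
  | Sto (a e : expr)
  | Seq (c1 c2 : cmd)
  | If (a b : expr) (c1 c2 : cmd)
  | While (a b : expr) (c : cmd).

Record state : Type := State { rg : nat -> nat; mm : nat -> nat; ck : nat }.

(** [eqn] rather than [==] lets [cbn] compute lookups at concrete registers. *)
Definition updn (f : nat -> nat) (d z : nat) : nat -> nat :=
  fun x => if eqn x d then z else f x.

(** Assignments, stores and tests cost one tick each. Evaluating an expression is free, which is
    harmless when the sizes of expressions are bounded. *)
Definition setr s x v := State (updn (rg s) x v) (mm s) (ck s).+1.
Definition setm s a v := State (rg s) (updn (mm s) a v) (ck s).+1.
Definition tick s := State (rg s) (mm s) (ck s).+1.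

Fixpoint eval (e : expr) (s : state) : nat :=
  match e with
  | Var x => rg s x
  | Cst z => z
  | EAdd a b => eval a s + eval b s
  | ESub a b => eval a s - eval b s
  | EMul a b => eval a s * eval b s
  | EDiv a b => eval a s %/ eval b s
  | ELd a => mm s (eval a s)
  end.

Fixpoint safe (S : nat) (e : expr) (s : state) : Prop :=
  match e with
  | Var _ | Cst _ => True
  | EAdd a b | ESub a b | EMul a b | EDiv a b => safe S a s /\ safe S b s
  | ELd a => safe S a s /\ eval a s < S
  end.

(** The body enters only through its transformer [F], so that the recursion on fuel can be nested in
    the structural recursion of [wp]. Fuel counts passes through the body; running out of it is
    failure, so termination is part of the specification. *)
Fixpoint wloop (S : nat) (a b : expr) (F : (state -> Prop) -> state -> Prop)
    (Q : state -> Prop) (fuel : nat) (s : state) : Prop :=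
  [/\ safe S a s, safe S b s
    & if eval a s < eval b s then
        if fuel is f.+1 then F (wloop S a b F Q f) (tick s) else False
      else Q (tick s)].

(* The predicate transformer of total correctness; [V] bounds every value that
   is assigned or stored, [S] every address. *)
Fixpoint wp (V S : nat) (c : cmd) (Q : state -> Prop) (s : state) : Prop :=
  match c with
  | Asg x e => [/\ safe S e s, eval e s <= V & Q (setr s x (eval e s))]
  | Sto a e => [/\ safe S a s, safe S e s, eval a s < S, eval e s <= V
                 & Q (setm s (eval a s) (eval e s))]
  | Seq c1 c2 => wp V S c1 (wp V S c2 Q) s
  | If a b c1 c2 => [/\ safe S a s, safe S b s
      & if eval a s <= eval b s then wp V S c1 Q (tick s)
        else wp V S c2 Q (tick s)]
  | While a b c => exists fuel, wloop S a b (wp V S c) Q fuel s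
  end.

(** * Compilation *)

Fixpoint csize (e : expr) : nat :=
  match e with
  | Var _ => 2
  | Cst _ => 1
  | EAdd a b | EMul a b | EDiv a b => csize a + csize b + 1
  | ESub a b => csize a + csize b + 4
  | ELd a => csize a + 6
  end.

(* A memory word [w] is read as [max 0 (w + 1)] and [z] is stored as [z - 1]:
   this keeps all values natural without losing the sign of the input. *)
Fixpoint cexp (d pos : nat) (e : expr) : program :=
  match e with
  | Var x => [:: Const d 0; Add d d x]
  | Cst z => [:: Const d (Posz z)]
  | EAdd a b => cexp d pos a ++ cexp d.+1 (pos + csize a) b
                 ++ [:: Add d d d.+1]
  | EMul a b => cexp d pos a ++ cexp d.+1 (pos + csize a) b
                 ++ [:: Mul d d d.+1]
  | EDiv a b => cexp d pos a ++ cexp d.+1 (pos + csize a) b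
                 ++ [:: Div d d d.+1]
  | ESub a b => cexp d pos a ++ cexp d.+1 (pos + csize a) b
      ++ [:: Sub d d d.+1; Const d.+1 0;
             JumpLe d.+1 d (pos + csize (ESub a b)); Const d 0]
  | ELd a => cexp d pos a ++
      [:: Fetch d d; Const d.+1 1; Add d d d.+1; Const d.+1 0;
          JumpLe d.+1 d (pos + csize (ELd a)); Const d 0]
  end.

Fixpoint ccsize (c : cmd) : nat :=
  match c with
  | Asg _ e => csize e + 2
  | Sto a e => csize a + csize e + 3
  | Seq c1 c2 => ccsize c1 + ccsize c2
  | If a b c1 c2 => csize a + csize b + 2 + ccsize c2 + ccsize c1
  | While a b c => csize a + csize b + 2 + ccsize c
  end.

(** Registers from [K] on hold temporaries. The second branch of [If] is laid out before the first
    one, because the only conditional jump is taken when the test holds. *)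
Fixpoint ccmd (K pos : nat) (c : cmd) : program :=
  match c with
  | Asg x e => cexp K pos e ++ [:: Const K.+1 0; Add x K K.+1]
  | Sto a e => cexp K pos a ++ cexp K.+1 (pos + csize a) e
      ++ [:: Const K.+2 1; Sub K.+1 K.+1 K.+2; Store K K.+1]
  | Seq c1 c2 => ccmd K pos c1 ++ ccmd K (pos + ccsize c1) c2
  | If a b c1 c2 =>
      let h := pos + csize a + csize b in
      cexp K pos a ++ cexp K.+1 (pos + csize a) b
      ++ [:: JumpLe K K.+1 (h + 2 + ccsize c2)]
      ++ ccmd K h.+1 c2 ++ [:: Jump (pos + ccsize (If a b c1 c2))]
      ++ ccmd K (h + 2 + ccsize c2) c1
  | While a b c =>
      let h := pos + csize a + csize b in
      cexp K pos a ++ cexp K.+1 (pos + csize a) b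
      ++ [:: JumpLe K.+1 K (pos + ccsize (While a b c))]
      ++ ccmd K h.+1 c ++ [:: Jump pos]
  end.

Lemma size_cexp d pos e : size (cexp d pos e) = csize e.
Proof.
by elim: e d pos => [x|z|a IHa b IHb|a IHa b IHb|a IHa b IHb|a IHa b IHb|a IHa]
  d pos //=; rewrite !size_cat ?IHa ?IHb /=; lia.
Qed.

Lemma size_ccmd K pos c : size (ccmd K pos c) = ccsize c.
Proof.
elim: c pos => [x e|a e|c1 IH1 c2 IH2|a b c1 IH1 c2 IH2|a b c IH] pos /=.
- by rewrite size_cat size_cexp.
- by rewrite !size_cat !size_cexp /=; lia.
- by rewrite size_cat IH1 IH2.
- by rewrite !(size_cat, size_cexp) /= !(size_cat, IH2) /= IH1; lia.
- by rewrite !(size_cat, size_cexp) /= !(size_cat, IH) /=; lia.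
Qed.

(** * Placement of code and bounds on intermediate values *)

Fixpoint code_at (P : program) (pos : nat) (l : program) : Prop :=
  if l is i :: l' then onth P pos = Some i /\ code_at P pos.+1 l' else True.

Lemma code_at_cat P pos a b :
  code_at P pos (a ++ b) <-> code_at P pos a /\ code_at P (pos + size a) b.
Proof.
elim: a pos => [|i a IH] pos /=; first by rewrite addn0; tauto.
by rewrite IH addSnnS; tauto.
Qed.

Lemma code_at_onth P pos l :
  (forall i, i < size l -> onth P (pos + i) = onth l i) -> code_at P pos l.
Proof.
elim: l pos => [|x l IH] pos H //=; split; first by have := H 0 isT; rewrite addn0.
by apply: IH => i Hi; rewrite addSnnS (H i.+1).
Qed.

(** An exponent: values are at most [V ^ weight e] if variables and memory are at most [V]. For a
    constant, [z.+1] is crude but sufficient, since [z < 2 ^ z]. *)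
Fixpoint weight (e : expr) : nat :=
  match e with
  | Var _ => 1
  | Cst z => z.+1
  | EAdd a b | ESub a b | EMul a b | EDiv a b => weight a + weight b
  | ELd a => weight a + 1
  end.

Fixpoint vars_lt (K : nat) (e : expr) : bool :=
  match e with
  | Var x => x < K
  | Cst _ => true
  | EAdd a b | ESub a b | EMul a b | EDiv a b => vars_lt K a && vars_lt K b
  | ELd a => vars_lt K a
  end.

(** The slack 4 covers the instructions that a command adds around its at most two expressions, so
    that these together take at most [2 * B] steps per tick. *)
Definition ewf (K B : nat) (e : expr) : bool :=
  [&& vars_lt K e, weight e <= B & csize e + 4 <= B].

Fixpoint cwf (K B : nat) (c : cmd) : bool :=
  match c with
  | Asg x e => (x < K) && ewf K B e
  | Sto a e => ewf K B a && ewf K B e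
  | Seq c1 c2 => cwf K B c1 && cwf K B c2
  | If a b c1 c2 => [&& ewf K B a, ewf K B b, cwf K B c1 & cwf K B c2]
  | While a b c => [&& ewf K B a, ewf K B b & cwf K B c]
  end.

Lemma weight_gt0 e : 0 < weight e.
Proof. by elim: e => //= *; lia. Qed.

Definition bounded (K V : nat) (s : state) : Prop :=
  (forall x, x < K -> rg s x <= V) /\ (forall i, mm s i <= V).

(** Positive powers of [V] are at least 2, so their sum is at most their product: addition, like
    multiplication, adds exponents. *)
Lemma eval_bound K V e s : 1 < V -> vars_lt K e -> bounded K V s ->
  eval e s <= V ^ weight e.
Proof.
move=> V1 + [Hr Hm].
have Vle w : 0 < w -> V <= V ^ w.
  by case: w => // w _; rewrite expnS leq_pmulr // expn_gt0 (ltnW V1).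
have pow_mul a b w1 w2 : a <= V ^ w1 -> b <= V ^ w2 ->
    (0 < w1) -> (0 < w2) -> a + b <= V ^ (w1 + w2) /\ a * b <= V ^ (w1 + w2).
  move=> Ha Hb H1 H2; rewrite expnD; split; last exact: leq_mul.
  apply: leq_trans (leq_add Ha Hb) _.
  by have := leq_trans V1 (Vle _ H1); have := leq_trans V1 (Vle _ H2); nia.
elim: e => [x|z|a IHa b IHb|a IHa b IHb|a IHa b IHb|a IHa b IHb|a IHa] /=.
- by move=> xK; rewrite expn1; apply: Hr.
- by move=> _; apply: leq_trans (ltnW (ltn_expl z.+1 V1)); rewrite ltnW.
- case/andP=> /IHa Ha /IHb Hb.
  by case: (pow_mul _ _ _ _ Ha Hb (weight_gt0 a) (weight_gt0 b)).
- case/andP=> /IHa Ha /IHb Hb.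
  by case: (pow_mul _ _ _ _ Ha Hb (weight_gt0 a) (weight_gt0 b)); lia.
- case/andP=> /IHa Ha /IHb Hb.
  by case: (pow_mul _ _ _ _ Ha Hb (weight_gt0 a) (weight_gt0 b)).
- case/andP=> /IHa Ha /IHb Hb; have := leq_div (eval a s) (eval b s).
  by case: (pow_mul _ _ _ _ Ha Hb (weight_gt0 a) (weight_gt0 b)); lia.
- move=> _; apply: leq_trans (Hm _) _.
  by apply: Vle; rewrite addn1.
Qed.

(** * Runs of the machine that respect the bounds *)

Definition good_config (P : program) (S W : nat) (c : config) : Prop :=
  (forall a, accesses P c a -> a < S) /\ words_bounded W c.

(** The last configuration is checked for word size only: its memory access belongs to the next
    instruction, so consecutive runs compose without overlap. *)
Definition reach (P : program) (S W t : nat) (c c' : config) : Prop :=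
  [/\ run P t c = Some c', words_bounded W c'
    & forall i c'', i < t -> run P i c = Some c'' -> good_config P S W c''].

Lemma run_add P t1 t2 c c1 :
  run P t1 c = Some c1 -> run P (t1 + t2) c = run P t2 c1.
Proof. by move=> H; rewrite addnC /run iterD -/(run P t1 c) H. Qed.

Lemma reach_trans P S W t1 t2 c c1 c2 :
  reach P S W t1 c c1 -> reach P S W t2 c1 c2 -> reach P S W (t1 + t2) c c2.
Proof.
move=> [r1 _ g1] [r2 w2 g2]; split=> //; first by rewrite (run_add _ r1).
move=> i c'' lti ri; case: (ltnP i t1) => [lt1|ge1]; first exact: g1 lt1 ri.
apply: (g2 (i - t1)); first by lia.
by rewrite -(run_add _ r1) subnKC.
Qed.

Lemma reach1 P S W c c' : words_bounded W c -> words_bounded W c' ->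
  step P c = Some c' -> (forall a, accesses P c a -> a < S) ->
  reach P S W 1 c c'.
Proof.
move=> wc wc' st acc; split=> //.
by case=> // c'' _ /= [<-].
Qed.

Lemma words_bounded_set W c d z : words_bounded W c -> `|z|%N <= W ->
  words_bounded W (set_reg c d z).
Proof.
by move=> H Hz i; have [] := H i; rewrite /= /upd; case: eqP.
Qed.

Lemma reach_const P S W c d z : onth P (pc c) = Some (Const d z) ->
  words_bounded W c -> `|z|%N <= W -> reach P S W 1 c (set_reg c d z).
Proof.
move=> H Hw Hz; apply: reach1 => //; first exact: words_bounded_set.
  by rewrite /step H.
by move=> a; rewrite /accesses H.
Qed.

Lemma reach_add P S W c d a b : onth P (pc c) = Some (Add d a b) ->
  words_bounded W c -> `|(reg c a + reg c b)%R|%N <= W ->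
  reach P S W 1 c (set_reg c d (reg c a + reg c b)%R).
Proof.
move=> H Hw Hz; apply: reach1 => //; first exact: words_bounded_set.
  by rewrite /step H.
by move=> i; rewrite /accesses H.
Qed.

Lemma reach_sub P S W c d a b : onth P (pc c) = Some (Sub d a b) ->
  words_bounded W c -> `|(reg c a - reg c b)%R|%N <= W ->
  reach P S W 1 c (set_reg c d (reg c a - reg c b)%R).
Proof.
move=> H Hw Hz; apply: reach1 => //; first exact: words_bounded_set.
  by rewrite /step H.
by move=> i; rewrite /accesses H.
Qed.

Lemma reach_mul P S W c d a b : onth P (pc c) = Some (Mul d a b) ->
  words_bounded W c -> `|(reg c a * reg c b)%R|%N <= W ->
  reach P S W 1 c (set_reg c d (reg c a * reg c b)%R).
Proof.
move=> H Hw Hz; apply: reach1 => //; first exact: words_bounded_set.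
  by rewrite /step H.
by move=> i; rewrite /accesses H.
Qed.

Lemma reach_div P S W c d a b : onth P (pc c) = Some (Div d a b) ->
  words_bounded W c -> `|(reg c a %/ reg c b)%Z|%N <= W ->
  reach P S W 1 c (set_reg c d (reg c a %/ reg c b)%Z).
Proof.
move=> H Hw Hz; apply: reach1 => //; first exact: words_bounded_set.
  by rewrite /step H.
by move=> i; rewrite /accesses H.
Qed.

Lemma reach_fetch P S W c d a i : onth P (pc c) = Some (Fetch d a) ->
  words_bounded W c -> reg c a = Posz i -> i < S ->
  reach P S W 1 c (set_reg c d (mem c i)).
Proof.
move=> H Hw Ha Hi; apply: reach1 => //.
- by apply: words_bounded_set => //; case: (Hw i).
- by rewrite /step H Ha.
- by move=> j; rewrite /accesses H Ha => -[<-].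
Qed.

Lemma reach_store P S W c a b i : onth P (pc c) = Some (Store a b) ->
  words_bounded W c -> reg c a = Posz i -> i < S ->
  reach P S W 1 c (Config (pc c).+1 (reg c) (upd (mem c) i (reg c b))).
Proof.
move=> H Hw Ha Hi; apply: reach1 => //.
- move=> j; have [H1 H2] := Hw j; rewrite /= /upd; case: eqP => // _.
  by have [] := Hw b.
- by rewrite /step H Ha.
- by move=> j; rewrite /accesses H Ha => -[<-].
Qed.

Lemma reach_jump P S W c l : onth P (pc c) = Some (Jump l) ->
  words_bounded W c -> reach P S W 1 c (Config l (reg c) (mem c)).
Proof.
move=> H Hw; apply: reach1 => //; first by rewrite /step H.
by move=> j; rewrite /accesses H.
Qed.

Lemma reach_jumple P S W c a b l : onth P (pc c) = Some (JumpLe a b l) ->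
  words_bounded W c ->
  reach P S W 1 c
    (Config (if (reg c a <= reg c b)%R then l else (pc c).+1) (reg c) (mem c)).
Proof.
move=> H Hw; apply: reach1 => //; first by rewrite /step H.
by move=> j; rewrite /accesses H.
Qed.

(** All negative words are seen as 0. A zero word reads as 1, so the memory beyond the input has to
    be cleared before it can serve as a table. *)
Definition view (z : int) : nat := if z is Posz a then a.+1 else 0.

Definition corr (K : nat) (s : state) (c : config) : Prop :=
  (forall x, x < K -> reg c x = Posz (rg s x)) /\
  (forall i, view (mem c i) = mm s i).

Definition clipped (z : int) : nat := if z is Posz a then a else 0.

Lemma upd_eq f d z : upd f d z d = z.
Proof. by rewrite /upd eqxx. Qed.

Lemma upd_neq f d z x : x != d -> upd f d z x = f x.
Proof. by rewrite /upd => /negPf ->. Qed.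

(** The common tail of subtractions and loads. Replacing a negative result by 0 makes subtraction
    truncated, and turns a fetched word plus 1 into its [view]. *)
Lemma reach_clip P S W c d : 0 < W -> words_bounded W c ->
  code_at P (pc c) [:: Const d.+1 0; JumpLe d.+1 d ((pc c) + 3); Const d 0] ->
  exists t c', [/\ reach P S W t c c', t <= 3, pc c' = pc c + 3,
    reg c' d = Posz (clipped (reg c d)) /\ (forall x, x < d -> reg c' x = reg c x)
    & mem c' = mem c].
Proof.
move=> W0 wb [H1 [H2 [H3 _]]].
have r1 := reach_const S H1 wb (leq0n W).
have [_ wb1 _] := r1.
have r2 := reach_jumple S (c := set_reg c d.+1 0) H2 wb1.
have r12 := reach_trans r1 r2; have [_ wb2 _] := r12.
move: r12 wb2; rewrite [reg _ _]upd_eq [reg _ _]upd_neq; last by lia.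
case: ifP => [ge0|lt0]; set c2 := Config _ _ _ => r12 wb2.
  exists 2, c2; split=> //; rewrite /c2 /=; split.
    by rewrite upd_neq; [case: (reg c d) ge0|lia].
  by move=> x xd; rewrite upd_neq //; lia.
have H3' : onth P (pc c2) = Some (Const d 0) by [].
have r3 := reach_const S H3' wb2 (leq0n W).
exists 3, (set_reg c2 d 0); split=> //.
- exact: reach_trans r12 r3.
- by rewrite /=; lia.
- split; first by rewrite /= upd_eq; case: (reg c d) lt0.
  by move=> x xd; rewrite /= !upd_neq //; lia.
Qed.

(** * Soundness of the compiler *)

Section Soundness.
Variables (P : program) (S V B K : nat).
Hypothesis V_gt1 : 1 < V.
Hypothesis B_gt0 : 0 < B.
Let W := V ^ B.

(** Registers below [d] survive, so the left operand stays in [d] while the right one is computed in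
    [d.+1]; program variables lie below [K <= d] and keep their values. *)
Lemma cexp_sound e : forall d c s,
  code_at P (pc c) (cexp d (pc c) e) -> K <= d -> vars_lt K e ->
  weight e <= B -> bounded K V s -> corr K s c -> words_bounded W c ->
  safe S e s ->
  exists t c', [/\ reach P S W t c c', t <= csize e, pc c' = pc c + csize e,
    reg c' d = Posz (eval e s) /\ (forall x, x < d -> reg c' x = reg c x)
    & mem c' = mem c].
Proof.
have VW a w : a <= V ^ w -> w <= B -> a <= W.
  by move=> H1 H2; apply: leq_trans H1 _; rewrite leq_pexp2l //; lia.
have W0 : 0 < W by rewrite expn_gt0; lia.
have VleW : V <= W by apply: (VW _ 1); rewrite ?expn1.
have corr_eq s c c' d : K <= d -> corr K s c -> mem c' = mem c ->
    (forall x, x < d -> reg c' x = reg c x) -> corr K s c'.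
  move=> Kd [Cr Cm] Em Er; split=> [x xK|i]; last by rewrite Em.
  by rewrite Er ?Cr //; lia.
(* The evaluation of both operands, shared by the four binary operators; [z] is the tail specific to
   the operator. *)
have bin a b (z : seq instr) :
    (forall d c s,
      code_at P (pc c) (cexp d (pc c) a) -> K <= d -> vars_lt K a ->
      weight a <= B -> bounded K V s -> corr K s c -> words_bounded W c ->
      safe S a s ->
      exists t c', [/\ reach P S W t c c', t <= csize a, pc c' = pc c + csize a,
        reg c' d = Posz (eval a s) /\ (forall x, x < d -> reg c' x = reg c x)
        & mem c' = mem c]) ->
    (forall d c s,
      code_at P (pc c) (cexp d (pc c) b) -> K <= d -> vars_lt K b ->
      weight b <= B -> bounded K V s -> corr K s c -> words_bounded W c ->
      safe S b s ->
      exists t c', [/\ reach P S W t c c', t <= csize b, pc c' = pc c + csize b,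
        reg c' d = Posz (eval b s) /\ (forall x, x < d -> reg c' x = reg c x)
        & mem c' = mem c]) ->
    forall d c s,
    code_at P (pc c) (cexp d (pc c) a ++ cexp d.+1 (pc c + csize a) b ++ z) ->
    K <= d -> vars_lt K a && vars_lt K b ->
    weight a + weight b <= B -> bounded K V s -> corr K s c ->
    words_bounded W c -> safe S a s /\ safe S b s ->
    exists t c', [/\ reach P S W t c c', t <= csize a + csize b,
      pc c' = pc c + (csize a + csize b) /\ code_at P (pc c') z,
      [/\ reg c' d = Posz (eval a s), reg c' d.+1 = Posz (eval b s)
        & (forall x, x < d -> reg c' x = reg c x)]
      & mem c' = mem c].
  move=> IHa IHb d c s /code_at_cat [Ca /code_at_cat [Cb Cz]] Kd.
  move=> /andP[va vb] wab bs cs wb [sa sb].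
  have wa : weight a <= B by lia.
  have wb' : weight b <= B by lia.
  have [t1 [c1 [r1 l1 p1 [e1 f1] m1]]] := IHa d c s Ca Kd va wa bs cs wb sa.
  have [_ wb1 _] := r1; have cs1 := corr_eq _ _ _ _ Kd cs m1 f1.
  rewrite size_cexp -p1 in Cb Cz.
  have [t2 [c2 [r2 l2 p2 [e2 f2] m2]]] :=
    IHb d.+1 c1 s Cb (leqW Kd) vb wb' bs cs1 wb1 sb.
  exists (t1 + t2), c2; split=> //; first exact: reach_trans r1 r2.
  - by lia.
  - by rewrite p2 p1 -addnA; split=> //; move: Cz; rewrite size_cexp p1 -addnA.
  - split=> //; first by rewrite f2.
    by move=> x xd; rewrite f2 ?f1 //; lia.
  - by rewrite m2.
elim: e => [x|z|a IHa b IHb|a IHa b IHb|a IHa b IHb|a IHa b IHb|a IHa] d c s.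
- move=> [H1 [H2 _]] Kd /= xK _ [br _] [Cr Cm] wb _.
  have r1 := reach_const S H1 wb (leq0n W); have [_ wb1 _] := r1.
  have rx : reg (set_reg c d 0) x = Posz (rg s x).
    by rewrite /= upd_neq ?Cr //; lia.
  have r2 := @reach_add P S W (set_reg c d 0) d d x H2 wb1.
  rewrite rx /= upd_eq add0r in r2.
  have {}r2 := r2 (leq_trans (br _ xK) VleW).
  exists 2, (set_reg (set_reg c d 0) d (Posz (rg s x))).
  split=> //; [exact: reach_trans r1 r2|by rewrite /=; lia|].
  by split; [rewrite /= upd_eq|move=> y yd; rewrite /= !upd_neq //; lia].
- move=> [H1 _] Kd /= _ wz _ _ wb _.
  have zW : z <= W.
    by apply: leq_trans (ltnW (ltn_expl z V_gt1)) _; apply: (VW _ z) => //; lia.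
  exists 1, (set_reg c d (Posz z)); split=> //.
  + exact: reach_const H1 wb zW.
  + by rewrite addn1.
  + by split; [rewrite /= upd_eq|move=> y yd; rewrite /= upd_neq //; lia].
- move=> Hc Kd vab wab bs cs wb sab.
  have [t [c1 [r1 l1 [p1 [H _]] [e1 e2 f1] m1]]] :=
    bin a b _ IHa IHb d c s Hc Kd vab wab bs cs wb sab.
  have [_ wb1 _] := r1.
  have := @reach_add P S W c1 d d d.+1 H wb1; rewrite e1 e2 -PoszD.
  have bd : eval (EAdd a b) s <= W.
    exact: VW (@eval_bound K V (EAdd a b) s V_gt1 vab bs) wab.
  move=> /(_ bd) r2.
  exists (t + 1), (set_reg c1 d (Posz (eval a s + eval b s))).
  split; [exact: reach_trans r1 r2|by rewrite /=; lia|by rewrite /=; lia| |by []].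
  by split; [rewrite /= upd_eq|move=> y yd; rewrite /= upd_neq ?f1 //; lia].
- move=> Hc Kd vab wab bs cs wb sab.
  have [t [c1 [r1 l1 [p1 [H Hclip]] [e1 e2 f1] m1]]] :=
    bin a b _ IHa IHb d c s Hc Kd vab wab bs cs wb sab.
  have [_ wb1 _] := r1.
  have := @reach_sub P S W c1 d d d.+1 H wb1; rewrite e1 e2.
  (* The bound on the sum also bounds the absolute value of the difference before clipping. *)
  have bd : eval (EAdd a b) s <= W.
    exact: VW (@eval_bound K V (EAdd a b) s V_gt1 vab bs) wab.
  have bd' : `|(Posz (eval a s) - Posz (eval b s))%R|%N <= W.
    by move: bd => /=; lia.
  move=> /(_ bd') r2.
  have [_ wb2 _] := r2.
  have := @reach_clip P S W (set_reg c1 d (Posz (eval a s) - Posz (eval b s))%R) d W0 wb2.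
  case.
    move: Hclip; rewrite [pc (set_reg _ _ _)]/= p1.
    by rewrite (_ : pc c + csize (ESub a b) = (pc c + (csize a + csize b)).+1 + 3) //= ; lia.
  move=> t3 [c3 [r3 l3 p3 [e3 f3] m3]].
  exists (t + 1 + t3), c3; split=> //.
  + by apply: reach_trans r3; apply: reach_trans r1 r2.
  + by rewrite /=; lia.
  + by rewrite p3 /= p1; lia.
  + split; last by move=> y yd; rewrite f3 //= upd_neq ?f1 //; lia.
    by rewrite e3 /= upd_eq /clipped; congr Posz; case E: (_ - _)%R => [m|m]; lia.
  + by rewrite m3.
- move=> Hc Kd vab wab bs cs wb sab.
  have [t [c1 [r1 l1 [p1 [H _]] [e1 e2 f1] m1]]] :=
    bin a b _ IHa IHb d c s Hc Kd vab wab bs cs wb sab.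
  have [_ wb1 _] := r1.
  have := @reach_mul P S W c1 d d d.+1 H wb1; rewrite e1 e2 -PoszM.
  have bd : eval (EMul a b) s <= W.
    exact: VW (@eval_bound K V (EMul a b) s V_gt1 vab bs) wab.
  move=> /(_ bd) r2.
  exists (t + 1), (set_reg c1 d (Posz (eval a s * eval b s))).
  split; [exact: reach_trans r1 r2|by rewrite /=; lia|by rewrite /=; lia| |by []].
  by split; [rewrite /= upd_eq|move=> y yd; rewrite /= upd_neq ?f1 //; lia].
- move=> Hc Kd vab wab bs cs wb sab.
  have [t [c1 [r1 l1 [p1 [H _]] [e1 e2 f1] m1]]] :=
    bin a b _ IHa IHb d c s Hc Kd vab wab bs cs wb sab.
  have [_ wb1 _] := r1.
  have := @reach_div P S W c1 d d d.+1 H wb1; rewrite e1 e2 divz_nat.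
  have bd : eval (EDiv a b) s <= W.
    exact: VW (@eval_bound K V (EDiv a b) s V_gt1 vab bs) wab.
  move=> /(_ bd) r2.
  exists (t + 1), (set_reg c1 d (Posz (eval a s %/ eval b s))).
  split; [exact: reach_trans r1 r2|by rewrite /=; lia|by rewrite /=; lia| |by []].
  by split; [rewrite /= upd_eq|move=> y yd; rewrite /= upd_neq ?f1 //; lia].
- move=> /code_at_cat [Ca Cz] Kd va wa bs cs wb [sa Sa].
  have wa' : weight a <= B by move: wa => /=; lia.
  have [t1 [c1 [r1 l1 p1 [e1 f1] m1]]] := IHa d c s Ca Kd va wa' bs cs wb sa.
  have [_ wb1 _] := r1.
  rewrite size_cexp -p1 in Cz; case: Cz => [H1 [H2 [H3 Hclip]]].
  have r2 := reach_fetch H1 wb1 e1 Sa; have [_ wb2 _] := r2.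
  set a0 := eval a s in r2 wb2 Sa.
  have r3 := @reach_const P S W (set_reg c1 d (mem c1 a0)) d.+1 1 H2 wb2 W0.
  have [_ wb3 _] := r3.
  set c3 := set_reg (set_reg _ _ _) _ _ in r3 wb3.
  have ed : reg c3 d = mem c1 a0 by rewrite /c3 /= upd_neq ?upd_eq //; lia.
  have ed1 : reg c3 d.+1 = 1 by rewrite /c3 /= upd_eq.
  have [Cr Cm] := cs.
  have viewE : view (mem c1 a0) = mm s a0 by rewrite m1 Cm.
  have bm : mm s a0 <= V by case: bs.
  have wm : `|mem c1 a0|%N <= W by case: (wb1 a0).
  have := @reach_add P S W c3 d d d.+1 H3 wb3; rewrite ed ed1.
  have bd : `|(mem c1 a0 + 1)%R|%N <= W.
    by move: viewE bm wm VleW; rewrite /view; case: (mem c1 a0) => z; lia.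
  move=> /(_ bd) r4; have [_ wb4 _] := r4.
  have := @reach_clip P S W (set_reg c3 d (mem c1 a0 + 1)%R) d W0 wb4.
  case.
    move: Hclip; rewrite [pc (set_reg _ _ _)]/= p1.
    by rewrite (_ : pc c + csize (ELd a) = (pc c + csize a).+3 + 3) //=; lia.
  move=> t5 [c5 [r5 l5 p5 [e5 f5] m5]].
  exists (t1 + 1 + 1 + 1 + t5), c5; split=> //.
  + by apply: reach_trans r5; apply: reach_trans r4; apply: reach_trans r3;
      apply: reach_trans r1 r2.
  + by rewrite /=; lia.
  + by rewrite p5 /= p1; lia.
  + split; last by move=> y yd; rewrite f5 //= !upd_neq ?f1 //; lia.
    rewrite e5 /= upd_eq -/a0 -viewE /view /clipped; congr Posz.
    by case: (mem c1 a0) => z; case E: (_ + _)%R => [m|m]; lia.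
  + by rewrite m5.
Qed.

Lemma corr_frame s c c' : corr K s c -> mem c' = mem c ->
  (forall x, x < K -> reg c' x = reg c x) -> corr K s c'.
Proof.
by move=> [Cr Cm] Em Er; split=> [x xK|i]; rewrite ?Em ?Er ?Cr.
Qed.

Lemma cexp2_sound a b z c s :
  code_at P (pc c) (cexp K (pc c) a ++ cexp K.+1 (pc c + csize a) b ++ z) ->
  ewf K B a -> ewf K B b -> bounded K V s -> corr K s c ->
  words_bounded W c -> safe S a s -> safe S b s ->
  exists t c', [/\ reach P S W t c c', t <= csize a + csize b,
    pc c' = pc c + csize a + csize b /\ code_at P (pc c') z,
    reg c' K = Posz (eval a s) /\ reg c' K.+1 = Posz (eval b s)
    & corr K s c'].
Proof.
move=> /code_at_cat [Ca /code_at_cat [Cb Cz]] /and3P[va wa _] /and3P[vb wb _].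
move=> bs cs wc sa sb.
have [t1 [c1 [r1 l1 p1 [e1 f1] m1]]] :=
  cexp_sound Ca (leqnn K) va wa bs cs wc sa.
have [_ wb1 _] := r1; have cs1 := corr_frame cs m1 f1.
rewrite size_cexp -p1 in Cb Cz.
have [t2 [c2 [r2 l2 p2 [e2 f2] m2]]] :=
  cexp_sound Cb (leqnSn K) vb wb bs cs1 wb1 sb.
exists (t1 + t2), c2; split=> //.
- exact: reach_trans r1 r2.
- by lia.
- by rewrite p2 p1; split=> //; move: Cz; rewrite size_cexp p1.
- by rewrite f2.
- by apply: corr_frame cs1 m2 _ => x xK; apply: f2; lia.
Qed.

(** Amortization: each tick pays for [2 * B] machine steps. The inequality between clocks composes
    under sequencing and looping without a running time known in advance. *)
Lemma ccmd_sound cm : forall Q s c, cwf K B cm ->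
  code_at P (pc c) (ccmd K (pc c) cm) -> bounded K V s -> corr K s c ->
  words_bounded W c -> wp V S cm Q s ->
  exists t c' s', [/\ reach P S W t c c', pc c' = pc c + ccsize cm,
    Q s' /\ bounded K V s', corr K s' c'
    & t + 2 * B * ck s <= 2 * B * ck s'].
Proof.
have W0 : 0 < W by rewrite expn_gt0; lia.
have VleW : V <= W by rewrite /W -[X in X <= _]expn1 leq_exp2l.
elim: cm => [x e|a e|c1 IH1 c2 IH2|a b c1 IH1 c2 IH2|a b cm IH] Q s c.
- move=> /= /andP[xK /and3P[ve we ce]] /code_at_cat [Ce [H1 [H2 _]]] bs cs wb.
  case=> se Ve HQ.
  have [t1 [c1 [r1 l1 p1 [e1 f1] m1]]] :=
    cexp_sound Ce (leqnn K) ve we bs cs wb se.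
  have [_ wb1 _] := r1; have [Cr1 Cm1] := corr_frame cs m1 f1.
  rewrite size_cexp -p1 in H1 H2.
  have r2 := reach_const S H1 wb1 (leq0n W); have [_ wb2 _] := r2.
  have := @reach_add P S W (set_reg c1 K.+1 0) x K K.+1 H2 wb2.
  rewrite [reg _ K]upd_neq; last by lia.
  rewrite [reg _ K.+1]upd_eq e1 addr0 => /(_ (leq_trans Ve VleW)) r3.
  exists (t1 + 1 + 1), (set_reg (set_reg c1 K.+1 0) x (Posz (eval e s))),
    (setr s x (eval e s)).
  split=> //.
  + by apply: reach_trans r3; apply: reach_trans r1 r2.
  + by rewrite /= p1; lia.
  + split=> //; case: bs => br bm; split=> // y yK.
    by rewrite /= /updn eqnE; case: eqP => // _; apply: br.
  + split=> // y yK; rewrite /= /updn eqnE /upd; case: (y == x) => //.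
    by rewrite ifF ?Cr1 //; lia.
  + by rewrite /=; nia.
- move=> /= /andP[wa we] Hc bs cs wb [sa se Sa Ve HQ].
  have [t1 [c1 [r1 l1 [p1 [H1 [H2 [H3 _]]]] [e1 e2] [Cr1 Cm1]]]] :=
    cexp2_sound Hc wa we bs cs wb sa se.
  have [_ wb1 _] := r1.
  have r2 := @reach_const P S W c1 K.+2 1 H1 wb1 W0; have [_ wb2 _] := r2.
  set c2 := set_reg c1 _ _ in r2 wb2.
  have := @reach_sub P S W c2 K.+1 K.+1 K.+2 H2 wb2.
  have -> : reg c2 K.+1 = Posz (eval e s) by rewrite /c2 /= upd_neq ?e2 //; lia.
  have -> : reg c2 K.+2 = 1 by rewrite /c2 /= upd_eq.
  have Hb : `|(Posz (eval e s) - 1)%R|%N <= W by lia.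
  move=> /(_ Hb) r3; have [_ wb3 _] := r3.
  set c3 := set_reg c2 _ _ in r3 wb3.
  have e3 : reg c3 K = Posz (eval a s).
    by rewrite /c3 /c2 /= !upd_neq ?e1 //; lia.
  have r4 := @reach_store P S W c3 K K.+1 (eval a s) H3 wb3 e3 Sa.
  have e4 : reg c3 K.+1 = (Posz (eval e s) - 1)%R by rewrite /c3 /= upd_eq.
  rewrite e4 in r4.
  eexists (t1 + 1 + 1 + 1), _, (setm s (eval a s) (eval e s)).
  split.
  + by apply: reach_trans r4; apply: reach_trans r3; apply: reach_trans r1 r2.
  + by rewrite /= p1; lia.
  + split=> //; case: bs => br bm; split=> // y.
    by rewrite /= /updn eqnE; case: eqP => // _; apply: br.
  + split=> [y yK|i]; first by rewrite /c3 /c2 /= !upd_neq ?Cr1 //; lia.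
    rewrite /= /updn eqnE /upd; case: (i == _); last by rewrite -Cm1.
    by rewrite /view; case E: (_ - _)%R => [m|m]; lia.
  + by case/and3P: wa => _ _ ?; case/and3P: we => _ _ ?; rewrite /=; nia.
- move=> /= /andP[w1 w2] /code_at_cat [C1 C2] bs cs wb HQ.
  have [t1 [d1 [s1 [r1 p1 [Q1 bs1] cs1 k1]]]] := IH1 _ _ _ w1 C1 bs cs wb HQ.
  have [_ wb1 _] := r1.
  rewrite size_ccmd -p1 in C2.
  have [t2 [d2 [s2 [r2 p2 Q2 cs2 k2]]]] := IH2 _ _ _ w2 C2 bs1 cs1 wb1 Q1.
  exists (t1 + t2), d2, s2; split=> //; first exact: reach_trans r1 r2.
  + by rewrite p2 p1; lia.
  + by lia.
- move=> /= /and4P[wa we w1 w2] Hc bs cs wb [sa sb HQ].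
  have [t0 [d0 [r0 l0 [p0 [H1 /code_at_cat [C2 [HJ C1]]]] [e1 e2] cs0]]] :=
    cexp2_sound Hc wa we bs cs wb sa sb.
  have [_ wb0 _] := r0; rewrite size_ccmd in HJ C1.
  have := @reach_jumple P S W d0 K K.+1 _ H1 wb0; rewrite e1 e2 lez_nat.
  case/and3P: wa => _ _ la; case/and3P: we => _ _ le.
  case: ifP HQ => _ HQ rj; have [_ wbj _] := rj.
    set dj := Config _ _ _ in rj wbj.
    have Cj : code_at P (pc dj) (ccmd K (pc dj) c1).
      rewrite /dj /=; move: C1; rewrite p0.
      by rewrite (_ : (_ + ccsize c2).+1 = pc c + csize a + csize b + 2 + ccsize c2) //; lia.
    have [t2 [d2 [s2 [r2 p2 Q2 cs2 k2]]]] :=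
      IH1 Q (tick s) dj w1 Cj bs cs0 wbj HQ.
    exists (t0 + 1 + t2), d2, s2; split=> //.
    + by apply: reach_trans r2; apply: reach_trans r0 rj.
    + by rewrite p2 /dj /=; lia.
    + by move: k2; rewrite /= mulnS; lia.
  set dj := Config _ _ _ in rj wbj.
  have Cj : code_at P (pc dj) (ccmd K (pc dj) c2) by rewrite /dj /= p0; rewrite p0 in C2.
  have [t2 [d2 [s2 [r2 p2 [Q2 bs2] cs2 k2]]]] :=
    IH2 Q (tick s) dj w2 Cj bs cs0 wbj HQ.
  have [_ wb2 _] := r2.
  have HJ' : onth P (pc d2) = Some (Jump (pc c + ccsize (If a b c1 c2))).
    by rewrite p2 [pc dj]/= HJ.
  have r3 := reach_jump S HJ' wb2.
  exists (t0 + 1 + t2 + 1), (Config (pc c + ccsize (If a b c1 c2)) (reg d2) (mem d2)), s2.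
  split=> //.
  + by apply: reach_trans r3; apply: reach_trans r2; apply: reach_trans r0 rj.
  + by move: k2; rewrite /= mulnS; lia.
- move=> /= /and3P[wa we wc] Hc bs cs wb [fuel HQ].
  elim: fuel s c Hc bs cs wb HQ => [|fuel IHf] s c Hc bs cs wb /=.
    case=> sa sb; case: ltnP => // leab HQ.
    have [t0 [d0 [r0 l0 [p0 [H1 _]] [e1 e2] cs0]]] :=
      cexp2_sound Hc wa we bs cs wb sa sb.
    have [_ wb0 _] := r0.
    have := @reach_jumple P S W d0 K.+1 K _ H1 wb0; rewrite e1 e2 lez_nat leab.
    set dj := Config _ _ _ => rj; exists (t0 + 1), dj, (tick s); split=> //.
    + exact: reach_trans r0 rj.
    + by case/and3P: wa => _ _ ?; case/and3P: we => _ _ ?; rewrite /=; nia.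
  case=> sa sb; case: ltnP => [ltab|leab] HQ;
    have [t0 [d0 [r0 l0 [p0 [H1 H2]] [e1 e2] cs0]]] :=
      cexp2_sound Hc wa we bs cs wb sa sb;
    have [_ wb0 _] := r0;
    have := @reach_jumple P S W d0 K.+1 K _ H1 wb0; rewrite e1 e2 lez_nat;
    case/and3P: (wa) => _ _ la; case/and3P: (we) => _ _ le; last first.
    rewrite leab; set dj := Config _ _ _ => rj; exists (t0 + 1), dj, (tick s); split=> //.
    + exact: reach_trans r0 rj.
    + by rewrite /=; nia.
  rewrite leqNgt ltab /= => rj; have [_ wbj _] := rj.
  set dj := Config _ _ _ in rj wbj.
  case/code_at_cat: H2 => C2 [HJ _].
  have Cj : code_at P (pc dj) (ccmd K (pc dj) cm) by rewrite /dj /= p0; rewrite p0 in C2.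
  have [t2 [d2 [s2 [r2 p2 [Q2 bs2] cs2 k2]]]] :=
    IH _ (tick s) dj wc Cj bs cs0 wbj HQ.
  have [_ wb2 _] := r2.
  have HJ' : onth P (pc d2) = Some (Jump (pc c)).
    by rewrite p2 /dj /= -HJ size_ccmd.
  have r3 := reach_jump S HJ' wb2; have [_ wb3 _] := r3.
  have [t4 [d4 [s4 [r4 p4 Q4 cs4 k4]]]] := IHf s2 (Config (pc c) (reg d2) (mem d2)) Hc bs2 cs2 wb3 Q2.
  exists (t0 + 1 + t2 + 1 + t4), d4, s4; split=> //.
  + by apply: reach_trans r4; apply: reach_trans r3; apply: reach_trans r2;
      apply: reach_trans r0 rj.
  + by move: k2 k4; rewrite /= mulnS; lia.
Qed.

End Soundness.

(** * Rules for the structured language *)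

Lemma wp_mono V S c (Q Q' : state -> Prop) s :
  (forall s', Q s' -> Q' s') -> wp V S c Q s -> wp V S c Q' s.
Proof.
elim: c Q Q' s => [x e|a e|c1 IH1 c2 IH2|a b c1 IH1 c2 IH2|a b c IH] Q Q' s HQ /=.
- by case=> ? ? /HQ.
- by case=> ? ? ? ? /HQ.
- by apply: IH1 => s'; apply: IH2.
- by case=> ? ?; case: ifP => _ H; split=> //; [apply: IH1 H|apply: IH2 H].
- case=> fuel H; exists fuel; elim: fuel s H => [|f IHf] s /=.
    by case=> ? ?; case: ifP => // _ /HQ.
  case=> ? ?; case: ifP => [_ H|_ /HQ //]; split=> //.
  by apply: IH H => s'; apply: IHf.
Qed.

Fixpoint writes (c : cmd) : seq nat :=
  match c with
  | Asg x _ => [:: x]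
  | Sto _ _ => [::]
  | Seq c1 c2 | If _ _ c1 c2 => writes c1 ++ writes c2
  | While _ _ c => writes c
  end.

Fixpoint nostore (c : cmd) : bool :=
  match c with
  | Asg _ _ => true
  | Sto _ _ => false
  | Seq c1 c2 | If _ _ c1 c2 => nostore c1 && nostore c2
  | While _ _ c => nostore c
  end.

Definition same (c : cmd) (s s' : state) : Prop :=
  (forall x, x \notin writes c -> rg s' x = rg s x) /\
  (nostore c -> mm s' = mm s).

(** Whatever a command does not write syntactically is preserved, so loop invariants need to mention
    only what changes. *)
Lemma wp_frame V S c Q s : wp V S c Q s -> wp V S c (fun s' => Q s' /\ same c s s') s.
Proof.
elim: c Q s => [x e|a e|c1 IH1 c2 IH2|a b c1 IH1 c2 IH2|a b c IH] Q s /=.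
- case=> ? ? ?; split=> //; split=> //; split=> // y.
  by rewrite inE /= /updn eqnE => /negPf ->.
- by case=> ? ? ? ? ?; split.
- move=> /IH1; apply: wp_mono => s1 [/IH2 H [f1 m1]].
  apply: wp_mono H => s2 [H [f2 m2]]; split=> //; split=> [y|].
    by rewrite /= mem_cat negb_or => /andP[y1 y2]; rewrite f2 ?f1.
  by case/andP=> n1 n2; rewrite m2 ?m1.
- case=> ? ?; case: ifP => _ H; split=> //; [move: H => /IH1 | move: H => /IH2];
    apply: wp_mono => s1 [H [f1 m1]]; split=> //; split=> [y|/andP[n1 n2]];
    by rewrite ?m1 //= mem_cat negb_or => /andP[y1 y2]; rewrite f1.
- case=> fuel H0; exists fuel.
  suff gen f s1 : wloop S a b (wp V S c) Q f s1 -> same c s s1 ->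
      wloop S a b (wp V S c) (fun s' => Q s' /\ same c s s') f s1 by exact: gen.
  elim: f s1 => [|f IHf] s1 /=.
    by case=> ? ?; case: ifP => // _ H sm; split.
  case=> ? ?; case: ifP => [_ H [f1 m1]|_ H sm]; split=> //.
  move: H => /IH; apply: wp_mono => s2 [H [f2 m2]].
  by apply: IHf => //; split=> [y yw|ns]; rewrite ?m2 ?f2 ?f1 ?m1.
Qed.

Definition For (x : nat) (e : expr) (c : cmd) : cmd :=
  Seq (Asg x (Cst 0)) (While (Var x) e (Seq c (Asg x (EAdd (Var x) (Cst 1))))).

(** The initialization takes one tick, each round two besides the body (test and increment), and the
    last test one. The premises expose these ticks through [setr] and [tick], so [I] can bound the
    clock. *)
Lemma wp_for V S x e c N (I : nat -> state -> Prop) (Q : state -> Prop) s :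
  N <= V ->
  (forall i s', i <= N -> same (For x e c) s s' -> I i s' ->
     safe S e s' /\ eval e s' = N) ->
  I 0 (setr s x 0) ->
  (forall i s', i < N -> same (For x e c) s s' -> rg s' x = i -> I i s' ->
     wp V S c (fun s2 => rg s2 x = i /\ I i.+1 (setr s2 x i.+1)) (tick s')) ->
  (forall s', same (For x e c) s s' -> rg s' x = N -> I N s' -> Q (tick s')) ->
  wp V S (For x e c) Q s.
Proof.
move=> NV He H0 Hstep HQ; split=> //; exists N.
set s0 := setr s x 0 in H0 *.
have same0 : same (For x e c) s s0.
  by split=> // y; rewrite inE negb_or /= /updn eqnE => /andP[/negPf ->].
suff gen j i s' : i + j = N -> same (For x e c) s s' -> rg s' x = i -> I i s' ->
    wloop S (Var x) e (wp V S (Seq c (Asg x (EAdd (Var x) (Cst 1))))) Q j s'.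
  by apply: (gen N 0) => //; rewrite /= /updn eqnE eqxx.
elim: j i s' => [|j IH] i s' ij sm xi Hi.
  have [se ev] := He i s' (eq_leq (etrans (esym (addn0 i)) ij)) sm Hi.
  rewrite /= ev xi; split=> //; rewrite ifF; last by lia.
  by apply: HQ; rewrite // -ij addn0.
have iN : i < N by lia.
have [se ev] := He i s' (ltnW iN) sm Hi.
rewrite /= ev xi; split=> //; rewrite iN.
have := wp_frame (Hstep i s' iN sm xi Hi).
apply: wp_mono => s2 [[x2 H2] [f2 m2]]; rewrite /= x2 addn1; split=> //.
  by lia.
apply: (IH i.+1) => //; [by lia| |by rewrite /= /updn eqnE eqxx].
case: sm => fs ms; split=> [y|]; rewrite /= ?inE.
  rewrite /updn eqnE mem_cat inE orbA orbC => H; move: (H).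
  by rewrite !negb_or => /and3P[y1 y2 y3]; rewrite (negPf y1) f2 // fs //=
    inE mem_cat inE !negb_or y1 y3.
by rewrite andbT => ns; rewrite m2 // ms /= ?ns.
Qed.

(** * Digits *)

(** Digits are least significant first. Base 3 encodes the splittings of the undetermined entries,
    base 2 the masks that index the tables. *)
Definition cod (b : nat) (g : nat -> nat) (k : nat) : nat :=
  \sum_(i < k) g i * b ^ i.

Lemma codS b g k : cod b g k.+1 = cod b g k + g k * b ^ k.
Proof. by rewrite /cod big_ord_recr. Qed.

Lemma eq_cod b g h k : (forall i, i < k -> g i = h i) -> cod b g k = cod b h k.
Proof. by move=> H; apply: eq_bigr => i _; rewrite H. Qed.

Lemma cod_lt b g k : (forall i, i < k -> g i < b) -> cod b g k < b ^ k.
Proof.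
elim: k => [|k IH] H; first by rewrite /cod big_ord0.
rewrite codS expnS.
have {}IH := IH (fun i ik => H i (ltnW ik)).
have := leq_mul (H k (ltnSn k)) (leqnn (b ^ k)); lia.
Qed.

Lemma cod_digit b g k i : i < k -> (forall j, j < k -> g j < b) ->
  cod b g k %/ b ^ i %% b = g i.
Proof.
elim: k => // k IH ik H.
have b0 : 0 < b by apply: leq_ltn_trans (H i ik).
have ck : cod b g k < b ^ k by apply: cod_lt => j jk; apply/H/ltnW.
have bp j : 0 < b ^ j by rewrite expn_gt0 b0.
rewrite codS; case: (ltngtP i k) ik => [ik _|lt|-> _]; last 1 first.
- by rewrite addnC divnMDl // divn_small // addn0 modn_small // H.
- have -> : g k * b ^ k = g k * b ^ (k - i.+1) * b * b ^ i.
    by rewrite -!mulnA -expnS -expnD subnK.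
  rewrite addnC divnMDl // modnMDl.
  by apply: IH => // j jk; apply/H/ltnW.
- by lia.
Qed.

Lemma cod_inj b g h k : (forall i, i < k -> g i < b) ->
  (forall i, i < k -> h i < b) -> cod b g k = cod b h k ->
  forall i, i < k -> g i = h i.
Proof. by move=> Hg Hh E i ik; rewrite -(cod_digit ik Hg) E cod_digit. Qed.

(** * The dynamic program over times *)

(* An entry [(a, v)] of the matrix is numbered [a * n + v].  The status of an
   entry at a given time is 0 if its value is smaller, 1 if it is equal, and 2
   if it is larger. *)
Definition compat (n : nat) (st : nat -> nat) (u v x : nat) : bool :=
  ~~ ((st (x * n + u) == 0) && (st (x * n + v) == 2)) &&
  ~~ ((st (x * n + v) == 0) && (st (x * n + u) == 2)).

Definition supported (n : nat) (st : nat -> nat) (p : nat) : bool :=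
  has (fun u => (st (p %/ n * n + u) == 0) &&
                all (compat n st u (p %% n)) (iota 0 n)) (iota 0 n).

Definition rel3 (B : nat -> nat) (t p : nat) : nat :=
  if B p < t then 0 else if B p <= t then 1 else 2.

Definition dig (c i : nat) : nat := c %/ 3 ^ i %% 3.

Lemma dig_lt c i : dig c i < 3.
Proof. exact: ltn_pmod. Qed.

Lemma entry_lt n x u : x < n -> u < n -> x * n + u < n * n.
Proof. by nia. Qed.

Lemma entry_div n p : p < n * n -> (p %/ n < n) && (p %% n < n).
Proof.
move=> pn; have n0 : 0 < n by nia.
by rewrite ltn_mod n0 andbT ltn_divLR.
Qed.

Lemma eq_supported n st st' p : p < n * n ->
  (forall q, q < n * n -> st q = st' q) -> supported n st p = supported n st' p.
Proof.
move=> /entry_div /andP[pd pm] H; apply: eq_in_has => u; rewrite mem_iota => /andP[_ un].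
rewrite H ?entry_lt //; congr (_ && _).
apply: eq_in_all => x; rewrite mem_iota => /andP[_ xn].
by rewrite /compat !H ?entry_lt.
Qed.

Section DynamicProgram.
Variables (n : nat) (L R : nat -> nat).
Let nn := n * n.

Definition undet (p : nat) : bool := L p != R p.
Definition undets : seq nat := [seq p <- iota 0 nn | undet p].
Let k := size undets.
Definition diag (p : nat) : bool := p %/ n == p %% n.
Definition times : seq nat :=
  [seq L p + j | p <- iota 0 nn, j <- iota 0 k.+1].

(** Bounds are arrival times plus one, hence 1 on the diagonal and more elsewhere. *)
Hypothesis LR : forall p, p < nn -> L p <= R p.
Hypothesis diag1 : forall p, p < nn -> diag p -> L p = 1 /\ R p = 1.
Hypothesis offdiag : forall p, p < nn -> ~~ diag p -> 1 < L p.

Definition realizes (A : nat -> nat) : Prop := forall p, p < nn ->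
  (L p <= A p <= R p) && (diag p || supported n (rel3 A (A p)) p).

Lemma timesP x :
  reflect (exists p j, [/\ p < nn, j <= k & x = L p + j]) (x \in times).
Proof.
apply: (iffP allpairsP) => [[pj []]|[p [j [pn jk ->]]]].
  rewrite !mem_iota => /andP[_ pn] /andP[_ jk] ->.
  by exists pj.1, pj.2; split=> //; lia.
by exists (p, j); rewrite !mem_iota; split=> //=; lia.
Qed.

Lemma mem_undets p : (p \in undets) = (p < nn) && undet p.
Proof. by rewrite mem_filter mem_iota /= andbC. Qed.

Lemma undets_uniq : uniq undets.
Proof. by rewrite filter_uniq // iota_uniq. Qed.

Lemma nth_undets i : i < k -> nth 0 undets i < nn /\ undet (nth 0 undets i).
Proof. by move=> ik; apply/andP; rewrite -mem_undets mem_nth. Qed.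

Lemma index_undets p : p < nn -> undet p ->
  index p undets < k /\ nth 0 undets (index p undets) = p.
Proof.
by move=> pn pu; rewrite /k index_mem mem_undets pn pu nth_index // mem_undets pn.
Qed.

Lemma L_gt0 p : p < nn -> 0 < L p.
Proof.
by move=> pn; case: (boolP (diag p)) => [/(diag1 pn) [->]|/(offdiag pn)] //; lia.
Qed.

(* A realization of minimal sum cannot have a value that is not a lower bound
   and whose predecessor is not attained: it could be decreased by one. *)
Lemma realizes_times A : realizes A ->
  exists2 A', realizes A' & forall p, p < nn -> A' p \in times.
Proof.
move: {2}(\sum_(p < nn) A p).+1 (ltnSn (\sum_(p < nn) A p)) => N.
elim: N A => // N IH A; rewrite ltnS => leN HA.
case: (boolP (all (fun p => A p \in times) (iota 0 nn))) => [/allP H|].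
  by exists A => // p pn; apply: H; rewrite mem_iota.
case/allPn=> p; rewrite mem_iota /= add0n => pn pT.
have A0 q : q < nn -> 0 < A q by move=> qn; have := L_gt0 qn; have /andP[] := HA q qn; lia.
case: (boolP (has (fun q => all (fun r => (L r != A q) && (A r != (A q).-1)) (iota 0 nn)) (iota 0 nn))).
  case/hasP=> q; rewrite mem_iota add0n => /= qn /allP Hq.
  have {}Hq r : r < nn -> L r <> A q /\ A r <> (A q).-1.
    by move=> rn; have /Hq/andP[/eqP ? /eqP ?] : r \in iota 0 nn by rewrite mem_iota.
  pose A' r := if A r == A q then (A q).-1 else A r.
  (* Moving a whole class of equal values down into a gap changes no comparison with another value,
     hence no support. *)
  have A'E r r' : r < nn -> r' < nn -> rel3 A' (A' r) r' = rel3 A (A r) r'.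
    move=> rn rn'; have [_ h1] := Hq r rn; have [_ h2] := Hq r' rn'; have h3 := A0 q qn.
    rewrite /rel3 /A'; case: eqP => e1; case: eqP => e2;
      by repeat case: ifP => // ?; lia.
  apply: (IH A'); last first.
    move=> r rn; have /andP[h1 h2] := HA r rn; have [h3 _] := Hq r rn.
    rewrite (eq_supported rn (fun q => A'E r q rn)) h2 andbT.
    by rewrite /A'; case: eqP => e1; lia.
  apply: leq_trans leN.
  rewrite (bigD1 (Ordinal qn)) //= [X in _ < X](bigD1 (Ordinal qn)) //=.
  rewrite -addSn leq_add //; first by rewrite /A' eqxx; have := A0 q qn; lia.
  by apply: leq_sum => r _; rewrite /A'; case: eqP; lia.
move=> /hasPn Hno.
(* No class can be moved. Going down from [A p], a value equal to some lower bound [L r] at distance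
   [j <= k] would put [A p] into [times]; so the predecessor is attained each time. *)
have Hdown j : j <= k -> exists2 q, q < nn & A q + j = A p.
  elim: j => [|j IHj] jk; first by exists p; rewrite ?addn0.
  have [q qn qj] := IHj (ltnW jk).
  have /Hno/allPn[r] : q \in iota 0 nn by rewrite mem_iota.
  rewrite mem_iota add0n negb_and !negbK => /= rn /orP[/eqP e|/eqP e].
    by case/negP: pT; apply/timesP; exists r, j; split=> //; [lia|rewrite e qj].
  by exists r => //; have := A0 q qn; lia.
(* These are [k.+1] distinct values. Each is attained by an undetermined entry, since a determined
   entry equals its lower bound, but there are only [k] of those. *)
have: size [seq A p - j | j <- iota 0 k.+1] <= size [seq A q | q <- undets].
  apply: uniq_leq_size.
    rewrite map_inj_in_uniq ?iota_uniq // => j1 j2; rewrite !mem_iota !add0n /= => h1 h2.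
    have [q1 q1n e1] := Hdown j1 h1; have [q2 q2n e2] := Hdown j2 h2.
    by lia.
  move=> x /mapP[j]; rewrite mem_iota add0n => /= jk ->.
  have [q qn qj] := Hdown j jk.
  apply/mapP; exists q; last by lia.
  rewrite mem_undets qn /=; apply/negP => /eqP LRq.
  have /andP[h _] := HA q qn.
  by case/negP: pT; apply/timesP; exists q, j; split=> //; lia.
by rewrite !size_map size_iota -/k ltnn.
Qed.

(** * Masks reachable at a given time *)

Definition partial_ok (B : nat -> nat) (t : nat) : Prop :=
  forall p, p < nn -> (undet p || (B p == L p)) /\
    (B p <= t -> [/\ L p <= B p <= R p, B p \in times
                   & diag p || supported n (rel3 B (B p)) p]).

Definition reachable (t : nat) (f : nat -> bool) : Prop :=
  exists2 B, partial_ok B t & forall i, i < k -> f i = (B (nth 0 undets i) <= t).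

Lemma L_times p : p < nn -> L p \in times.
Proof. by move=> pn; apply/timesP; exists p, 0; rewrite addn0. Qed.

(** Time 1 is time 0 before the shift, when only the diagonal is reached, and the diagonal is
    determined. *)
Lemma reachable_init f : reachable 1 f <-> forall i, i < k -> f i = false.
Proof.
have undet_L p : p < nn -> undet p -> 1 < L p.
  move=> pn pu; apply: offdiag => //; apply/negP => /(diag1 pn) [e1 e2].
  by rewrite /undet e1 e2 in pu.
split=> [[B HB Hf] i ik|Hf].
  rewrite Hf //; apply/negP => le1; have [pn pu] := nth_undets ik.
  by have [_ /(_ le1) [h _ _]] := HB _ pn; have := undet_L _ pn pu; lia.
exists (fun p => R p) => [p pn|i ik].
  split; first by rewrite /undet eq_sym; case: eqP.
  move=> le1; have h := LR pn; have h2 := L_gt0 pn.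
  have e : R p = L p by lia.
  rewrite e L_times // leqnn; split=> //.
  by apply/orP; left; apply/negPn/negP => /(offdiag pn); lia.
have [pn pu] := nth_undets ik; have := undet_L _ pn pu; have := LR pn.
by rewrite Hf //; lia.
Qed.

(** Once every entry is reached, no value is a placeholder. The converse is where the restriction to
    values in [times] needs [realizes_times]. *)
Lemma reachable_final t : (forall x, x \in times -> x <= t) ->
  reachable t (fun=> true) <-> exists A, realizes A.
Proof.
move=> Ht; split=> [[B HB Hf]|[A /realizes_times [B HB HT]]].
  exists B => p pn; have [h1 h2] := HB p pn.
  suff /h2 [-> _ ->] : B p <= t by [].
  case: (boolP (undet p)) h1 => [pu _|_ /= /eqP -> ]; last exact/Ht/L_times.
  by have [ik e] := index_undets pn pu; rewrite -{1}e -Hf.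
exists B => [p pn|i ik].
  have /andP[h1 h2] := HB p pn; split; last by rewrite HT.
  by rewrite /undet; case: eqP => //= e; apply/eqP; lia.
by have [pn _] := nth_undets ik; apply/esym/Ht/HT.
Qed.

Definition stat (t c p : nat) : nat :=
  if undet p then dig c (index p undets) else rel3 L t p.

Definition in_window (t c : nat) : bool :=
  all (fun i => (dig c i == 1) ==>
         (L (nth 0 undets i) <= t <= R (nth 0 undets i))) (iota 0 k).

Definition new_supported (t c : nat) : bool :=
  all (fun p => (stat t c p == 1) ==> supported n (stat t c) p) (iota 0 nn).

(** No candidate lies strictly between [t] and [t'], so an entry is smaller than [t'] exactly if it
    is reached at [t]. The code [c] guesses the splitting at [t']; values above the current time are
    placeholders and may be changed freely. *)
Lemma reachable_step t t' f : 0 < t -> t < t' -> t' \in times ->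
  (forall x, x \in times -> t < x -> t' <= x) ->
  reachable t' f <->
  exists c, [/\ c < 3 ^ k, in_window t' c && new_supported t' c,
    reachable t (fun i => dig c i == 0)
    & forall i, i < k -> f i = (dig c i <= 1)].
Proof.
move=> t0 tt' t'T Hgap; split=> [[B HB Hf]|[c [_ /andP[/allP Hwin /allP Hsup] [B HB Ho] Hf]]].
  pose g i := rel3 B t' (nth 0 undets i).
  have g3 i : i < k -> g i < 3 by rewrite /g /rel3; case: ifP => // _; case: ifP.
  have digE i : i < k -> dig (cod 3 g k) i = g i by move=> ik; apply: cod_digit.
  have statE p : p < nn -> stat t' (cod 3 g k) p = rel3 B t' p.
    move=> pn; rewrite /stat; case: ifP => [pu|pd].
      by have [ik e] := index_undets pn pu; rewrite digE // /g e.
    by have [] := HB p pn; rewrite pd /rel3 => /= /eqP -> _.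
  have ltle p : p < nn -> (B p < t') = (B p <= t).
    move=> pn; apply/idP/idP => [lt|]; last by lia.
    have [_ /(_ (ltnW lt)) [_ h _]] := HB p pn.
    by rewrite leqNgt; apply/negP => /(Hgap _ h); lia.
  exists (cod 3 g k); split.
  - exact: cod_lt.
  - apply/andP; split; apply/allP => i; rewrite mem_iota add0n /= => ik.
      rewrite digE // /g /rel3; apply/implyP.
      case: ltnP => // h1; case: leqP => // h2 _.
      have [pn _] := nth_undets ik.
      by have [_ /(_ h2) [h3 _ _]] := HB _ pn; lia.
    rewrite statE // (eq_supported ik statE); apply/implyP => e.
    have Bi : B i = t' by move: e; rewrite /rel3; case: ltnP => // ?; case: leqP => //; lia.
    have [_ /(_ (eq_leq Bi)) [_ _]] := HB i ik; rewrite Bi.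
    by case/orP=> // /(diag1 ik) [Li Ri]; have := HB i ik; rewrite /undet Li Ri Bi /=; lia.
  - exists B => [p pn|i ik].
      by have [h1 h2] := HB p pn; split=> // le; apply: h2; lia.
    have [pn _] := nth_undets ik.
    by rewrite digE // /g -ltle // /rel3; case: ltnP => //= _; case: ifP.
  - move=> i ik; rewrite digE // Hf // /g /rel3; case: ltnP => [h|h]; first by rewrite ltnW.
    by case: ifP.
(* Old entries keep their values, new ones get [t'], and [t'.+1] is a placeholder for the later
   ones. *)
pose B' p := if undet p then
    if dig c (index p undets) == 0 then B p
    else if dig c (index p undets) == 1 then t' else t'.+1
  else L p.
have Blow p : p < nn -> B p <= t -> B' p = B p.
  move=> pn le; rewrite /B'; case: ifP => [pu|pd].
    by have [ik e] := index_undets pn pu; rewrite Ho // e le.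
  by have [] := HB p pn; rewrite pd => /= /eqP.
have Bhigh p : p < nn -> t < B p -> t < B' p.
  move=> pn lt; rewrite /B'; case: ifP => [pu|pd].
    have [ik e] := index_undets pn pu; rewrite Ho // e [B p <= t]leqNgt lt /=.
    by case: ifP; lia.
  by have [] := HB p pn; rewrite pd => /= /eqP <-.
(* Only values above [t] have changed and they stay above [t], so earlier supports persist. *)
have rel3E s : s <= t -> forall p, p < nn -> rel3 B' s p = rel3 B s p.
  move=> st p pn; case: (leqP (B p) t) => h; first by rewrite /rel3 Blow.
  have := Bhigh p pn h; rewrite /rel3 => h'.
  by repeat case: ifP => // ?; lia.
have statE p : p < nn -> rel3 B' t' p = stat t' c p.
  move=> pn; rewrite /stat /rel3 /B'; case pu: (undet p) => //.
  have [ik e] := index_undets pn pu; have d3 := dig_lt c (index p undets).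
  case: eqP => [E0|E0].
    have h : B p <= t by rewrite -{1}e -Ho // E0.
    by rewrite E0 ifT //; lia.
  case: eqP => [->|E1]; first by rewrite ltnn leqnn.
  by rewrite !ifF; lia.
exists B' => [p pn|i ik]; last first.
  have [pn pu] := nth_undets ik; rewrite Hf // /B' pu index_uniq ?undets_uniq //.
  have := dig_lt c i; case: eqP => [d0 _|d0].
    by rewrite d0 /=; have := Ho i ik; rewrite d0 eqxx => /esym h; lia.
  by case: eqP => [->|d1] ?; lia.
split; first by rewrite /B'; case: ifP => //=.
move=> le; case: (leqP (B' p) t) => h.
  have lo : B p <= t by rewrite leqNgt; apply/negP => /(Bhigh p pn); lia.
  have e := Blow p pn lo; have [_ /(_ lo) [h1 h2 h3]] := HB p pn.
  by rewrite e; split=> //; rewrite (eq_supported pn (rel3E (B p) lo)).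
have pB : B' p = t'.
  apply/eqP; rewrite eqn_leq le /=.
  move: h; rewrite /B'; case: ifP => [pu|pd]; last by apply: Hgap; apply: L_times.
  have [ik e] := index_undets pn pu.
  case: ifP => [h1 h2|_]; last by case: ifP; lia.
  by move: h1; rewrite Ho // e; lia.
have st1 : stat t' c p = 1 by rewrite -statE // /rel3 pB ltnn leqnn.
rewrite pB t'T (eq_supported pn statE); split=> //; last first.
  have /Hsup/implyP -> : p \in iota 0 nn by rewrite mem_iota.
    by rewrite orbT.
  by rewrite st1.
move: pB; rewrite /B'; case: ifP => [pu|/negbFE/eqP <- <-]; last by rewrite leqnn.
have [ik e] := index_undets pn pu; move: st1; rewrite /stat pu => st1 _.
have /Hwin/implyP : index p undets \in iota 0 k by rewrite mem_iota.
by rewrite st1 e; apply.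
Qed.

End DynamicProgram.

(** * Foremost paths and supported matrices *)

Lemma FoP n (G : temporal_graph n) u v t : u != v ->
  Fo G u v = Some t <->
  arrives_at G u v t /\ (forall t', arrives_at G u v t' -> t <= t').
Proof.
move=> uv; rewrite mxE (negPf uv).
case: pselect => [ex|nex]; last first.
  by split=> // -[H _]; case: nex; exists t; apply/asboolP.
case: ex_minnP => m /asboolP Hm Hmin; split=> [[<-]|[Ht Htmin]].
  by split=> // t' /asboolP; apply: Hmin.
congr Some; apply/eqP; rewrite eqn_leq Htmin // andbT.
by apply: Hmin; apply/asboolP.
Qed.

Lemma follows_rcons n (G : temporal_graph n) u s w t :
  follows G u (rcons s (w, t)) <->
  [/\ follows G u s, [set last u (unzip1 s); w] \in edges G
    & lam G [set last u (unzip1 s); w] t].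
Proof.
elim: s u => [|[v t'] s IH] u /=; first by split=> [[]|[]].
by split=> [[? ? /IH []]|[[? ? ?] ? ?]]; split=> //; apply/IH.
Qed.

Lemma path_rcons n (G : temporal_graph n) u v s w t :
  strict_temporal_path G u v (rcons s (w, t)) <->
  [/\ strict_temporal_path G u (last u (unzip1 s)) s,
      [set last u (unzip1 s); w] \in edges G /\ lam G [set last u (unzip1 s); w] t,
      arrival s < t, w \notin u :: unzip1 s & w = v].
Proof.
(* For the empty path [arrival] is the default 0, and [arrival s < t] then says that the first label
   is positive. *)
have sortE : sorted ltn (unzip2 (rcons s (w, t))) /\ 0 < t <->
    sorted ltn (unzip2 s) /\ arrival s < t.
  rewrite /arrival /unzip2 map_rcons; case: s => [|[v' t'] s] /=.
    by split=> [[]|[]].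
  rewrite rcons_path; split=> [[/andP[]]|[-> h]] //; split=> //.
  by apply: leq_ltn_trans h.
have uniqE : uniq (u :: unzip1 (rcons s (w, t))) =
    (w \notin u :: unzip1 s) && uniq (u :: unzip1 s).
  by rewrite /unzip1 map_rcons -rcons_cons rcons_uniq.
rewrite /strict_temporal_path uniqE; split.
  case=> /follows_rcons [f1 f2 f3] /andP[h1 h2] h3; rewrite /unzip1 map_rcons last_rcons => h4.
  have [|s1 s2] := sortE.1 (conj h3 _); first exact: lam_pos f3.
  by split.
case=> -[g1 g2 g3 _] [f2 f3] h h1 h4.
have [|s1 s2] := sortE.2 _; first by [].
by split=> //; [apply/follows_rcons|rewrite h1|rewrite /unzip1 map_rcons last_rcons].
Qed.

Lemma path_prefix n (G : temporal_graph n) u v s w :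
  strict_temporal_path G u v s -> w \in unzip1 s ->
  exists2 s', strict_temporal_path G u w s' & arrival s' <= arrival s.
Proof.
elim/last_ind: s v => [|s [x t] IH] v // /[dup] Hp /path_rcons [Hs _ lt _ xv].
rewrite /unzip1 map_rcons mem_rcons inE => /orP[/eqP -> |ws].
  by rewrite -xv in Hp; exists (rcons s (x, t)).
have [s' Hs' le] := IH _ Hs ws; exists s' => //.
apply: leq_trans le (ltnW _); rewrite [X in _ < X]/arrival /unzip2 map_rcons last_rcons.
exact: lt.
Qed.

(** Appending the edge to a path that already visits [v] would repeat a vertex; its prefix up to [v]
    then arrives early enough. *)
Lemma arrives_edge n (G : temporal_graph n) x u v s t :
  (x = u /\ s = 0) \/ arrives_at G x u s -> s < t -> x != v ->
  [set u; v] \in edges G -> lam G [set u; v] t ->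
  exists2 t', t' <= t & arrives_at G x v t'.
Proof.
move=> Hs st xv ed la.
have [p Hp ps] : arrives_at G x u s.
  by case: Hs => [[<- ->]|//]; exists [::] => //; split.
case: (boolP (v \in unzip1 p)) => vp.
  by have [p' Hp' le] := path_prefix Hp vp; exists (arrival p'); [lia|exists p'].
have [_ _ _ lp] := Hp.
exists t => //; exists (rcons p (v, t)).
  apply/path_rcons; rewrite lp ps; split=> //.
  by rewrite inE negb_or vp eq_sym xv.
by rewrite /arrival /unzip2 map_rcons last_rcons.
Qed.

Lemma arrives_inv n (G : temporal_graph n) x v t : x != v -> arrives_at G x v t ->
  exists u s, [/\ [set u; v] \in edges G, lam G [set u; v] t, s < t
    & (x = u /\ s = 0) \/ (x != u /\ arrives_at G x u s)].
Proof.
move=> xv [p Hp <-]; case/lastP: p Hp => [[_ _ _ /= e]|p [w t'] /path_rcons].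
  by rewrite e eqxx in xv.
case=> Hp [ed la] lt _ <-; exists (last x (unzip1 p)), (arrival p).
have arrE : arrival (rcons p (w, t')) = t'.
  by rewrite /arrival /unzip2 map_rcons last_rcons.
rewrite arrE; split=> //.
case: (eqVneq x (last x (unzip1 p))) => [e|ne]; last by right; split=> //; exists p.
left; split=> //; case: Hp => _ + _ _; case: p e {ed la lt arrE} => //= -[y t1] p /= e /andP[].
by rewrite e mem_last.
Qed.

(** [u] plays the last vertex before [v] on a foremost path from [w]; the second half says that the
    edge [uv] at time [a w v] contradicts no entry of [a]. *)
Definition mx_supported n (a : 'I_n -> 'I_n -> nat) : Prop := forall w v, w != v ->
  exists u, a w u < a w v /\
    forall x, (a x u < a w v -> a x v <= a w v) /\ (a x v < a w v -> a x u <= a w v).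

(** The last edge of a foremost path is a support: it is present at time [a w v], so whoever reaches
    one end earlier can cross it. *)
Lemma Fo_supported n (G : temporal_graph n) (a : 'I_n -> 'I_n -> nat) :
  (forall u v, Fo G u v = Some (a u v)) ->
  [/\ forall u, a u u = 0, forall u v, u != v -> 0 < a u v & mx_supported a].
Proof.
move=> Ha.
have a0 u : a u u = 0 by have := Ha u u; rewrite mxE eqxx => -[].
have arr x u : (x = u /\ a x u = 0) \/ arrives_at G x u (a x u).
  case: (eqVneq x u) => [->|ne]; first by left; rewrite a0.
  by right; have /(FoP G _ ne) [] := Ha x u.
have ext x u v t : [set u; v] \in edges G -> lam G [set u; v] t ->
    a x u < t -> a x v <= t.
  move=> ed la lt; case: (eqVneq x v) => [->|xv]; first by rewrite a0.
  have [t' t't H] := arrives_edge (arr x u) lt xv ed la.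
  by have /(FoP G _ xv) [_ /(_ _ H)] := Ha x v; lia.
split=> // [u v uv|w v wv].
  have /(FoP G _ uv) [/(arrives_inv uv) [u' [s [_ _ lt _]]] _] := Ha u v.
  by lia.
have /(FoP G _ wv) [/(arrives_inv wv) [u [s [ed la lt H]]] _] := Ha w v.
exists u; split.
  case: H => [[<- _]|[wu H]]; first by rewrite a0; lia.
  by have /(FoP G _ wu) [_ /(_ _ H)] := Ha w u; lia.
move=> x; split; first exact: ext ed la.
by rewrite setUC in ed la; apply: ext ed la.
Qed.

(** The graph is complete, and each edge carries every positive time at which it contradicts no
    entry of [a]. No arrival is too early by this choice, and the supports yield paths that are
    early enough, by induction on the value. *)
Lemma supported_Fo n (a : 'I_n -> 'I_n -> nat) :
  (forall u, a u u = 0) -> (forall u v, u != v -> 0 < a u v) -> mx_supported a ->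
  exists G : temporal_graph n, forall u v, Fo G u v = Some (a u v).
Proof.
move=> a0 apos Hsup.
pose ed : {set {set 'I_n}} := [set e : {set 'I_n} | #|e| == 2].
pose la (e : {set 'I_n}) t := 0 < t /\
  forall x u v, u \in e -> v \in e -> a x u < t -> a x v <= t.
have edP e : e \in ed -> #|e| = 2 by rewrite inE => /eqP.
have laP e t : e \in ed -> la e t -> 0 < t by move=> _ [].
exists (TemporalGraph edP laP); set G := TemporalGraph _ _.
have low u v t : arrives_at G u v t -> a u v <= t.
  case=> s + <-; elim/last_ind: s v => [|s [x t'] IH] v; first by case=> _ _ _ /= <-; rewrite a0.
  case/path_rcons=> /IH le [_ [_ H]] lt _ <-.
  rewrite /arrival /unzip2 map_rcons last_rcons.
  by apply: H (leq_ltn_trans le lt); rewrite !inE eqxx ?orbT.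
move=> w v; case: (eqVneq w v) => [->|wv]; first by rewrite mxE eqxx a0.
apply/FoP => //; split; last by move=> t'; apply: low.
move: {2}(a w v).+1 (ltnSn (a w v)) => N; elim: N v wv => // N IH v wv leN.
have [u [lt Hx]] := Hsup w v wv.
have uv : u != v by apply/eqP => e; rewrite e ltnn in lt.
have Hu : (w = u /\ a w u = 0) \/ arrives_at G w u (a w u).
  case: (eqVneq w u) => [->|wu]; first by left.
  by right; apply: IH => //; lia.
have e1 : [set u; v] \in edges G by rewrite inE cards2 uv.
have e2 : lam G [set u; v] (a w v).
  split; first exact: apos.
  move=> x y z; rewrite !inE => /orP[]/eqP -> /orP[]/eqP -> //.
  - by lia.
  - by have [] := Hx x.
  - by have [] := Hx x.
  - by lia.
have [t' le H] := arrives_edge Hu lt wv e1 e2.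
by have := low _ _ _ H => ge; rewrite (_ : a w v = t') //; lia.
Qed.

(* Bounds in the shifted encoding of [view]: value [t] is represented by
   [t.+1].  Diagonal entries are fixed to 0, the others made positive. *)
Definition lo n (m : nat -> nat) (p : nat) : nat :=
  if diag n p then 1 else maxn (m (2 * p)) 2.
(** Raising the upper bound to [lo] collapses an empty range to one value, so bounds are always
    ordered and equal endpoints stay equal; [consistent] records whether the range was empty. *)
Definition hi n (m : nat -> nat) (p : nat) : nat :=
  if diag n p then 1 else maxn (m (2 * p).+1) (lo n m p).
Definition consistent n (m : nat -> nat) (p : nat) : bool :=
  if diag n p then (m (2 * p) <= 1) && (0 < m (2 * p).+1)
  else lo n m p <= m (2 * p).+1.

(** A negative endpoint is seen as 0: as a lower one it excludes no time, as an upper one every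
    time. *)
Lemma view_range (d : int * int) t :
  in_range d (Some t) = (view d.1 <= t.+1 <= view d.2).
Proof. by case: d => [[l|l] [r|r]] /=; rewrite /in_range /=; lia. Qed.

Lemma entryE n (u v : 'I_n) : ((u * n + v) %/ n = u) * ((u * n + v) %% n = v).
Proof.
have n0 : 0 < n by apply: leq_ltn_trans (ltn_ord u).
by rewrite divnMDl // modnMDl divn_small ?modn_small ?addn0.
Qed.

Lemma diagE n (u v : 'I_n) : diag n (u * n + v) = (u == v).
Proof. by rewrite /diag !entryE. Qed.

Lemma supportedP n (A : nat -> nat) t (w v : 'I_n) :
  reflect (exists u : 'I_n, A (w * n + u) < t /\
     forall x : 'I_n, (A (x * n + u) < t -> A (x * n + v) <= t) /\
                      (A (x * n + v) < t -> A (x * n + u) <= t))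
    (supported n (rel3 A t) (w * n + v)).
Proof.
have r0 p : (rel3 A t p == 0) = (A p < t) by rewrite /rel3; case: ifP => // _; case: ifP.
have r2 p : (rel3 A t p == 2) = (t < A p).
  by rewrite /rel3; case: ltnP => [h|h]; last case: leqP => // h'; lia.
apply: (iffP hasP) => [[u]|[u [lt H]]].
  rewrite mem_iota /= add0n !entryE => un /andP[]; rewrite r0 => lt /allP H.
  exists (Ordinal un); split=> // x.
  have /H : val x \in iota 0 n by rewrite mem_iota /=.
  by rewrite /compat !r0 !r2 /=; lia.
exists (val u); first by rewrite mem_iota /=.
rewrite !entryE r0 lt; apply/allP => x; rewrite mem_iota add0n /= => xn.
by have := H (Ordinal xn); rewrite /compat !r0 !r2 /=; lia.
Qed.

(** Clamping loses no solution, since foremost times are 0 on the diagonal and positive elsewhere;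
    [consistent] rejects the ranges that clamping would repair. *)
Lemma TGR_realizes n (D : 'M[int * int]_n) (m : nat -> nat) :
  (forall u v : 'I_n, m (2 * (u * n + v)) = view (D u v).1 /\
                      m (2 * (u * n + v)).+1 = view (D u v).2) ->
  Ranged_Foremost_TGR D <->
  (forall p, p < n * n -> consistent n m p) /\
  exists A, realizes n (lo n m) (hi n m) A.
Proof.
move=> Hm.
have allp (X : nat -> Prop) : (forall u v : 'I_n, X (u * n + v)) ->
    forall p, p < n * n -> X p.
  move=> H p /entry_div /andP[pd pm].
  by have := H (Ordinal pd) (Ordinal pm); rewrite /= -divn_eq.
split=> [[G HG]|[Hc [A HA]]].
  pose a u v := odflt 0 (Fo G u v).
  have Ha u v : Fo G u v = Some (a u v).
    by have := HG u v; rewrite /a; case: (Fo G u v) => //=; case: (D u v) => [[]].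
  have [a0 apos Hsup] := Fo_supported Ha.
  have HD u v : view (D u v).1 <= (a u v).+1 <= view (D u v).2.
    by rewrite -view_range -Ha.
  split.
    apply: (allp (consistent n m)) => u v; have := HD u v; have [e1 e2] := Hm u v.
    rewrite /consistent /lo diagE e1 e2; case: eqP => [->|/eqP/apos]; last by lia.
    by rewrite a0; lia.
  pose A p := if insub (p %/ n) is Some u then
    if insub (p %% n) is Some v then (a u v).+1 else 0 else 0.
  have AE (u v : 'I_n) : A (u * n + v) = (a u v).+1.
    by rewrite /A !entryE !valK.
  exists A; apply: allp => u v; apply/andP; split.
    have := HD u v; have [e1 e2] := Hm u v.
    rewrite AE /hi /lo diagE e1 e2; case: eqP => [->|/eqP/apos]; last by lia.
    by rewrite a0.
  rewrite diagE; case: eqVneq => //= uv; apply/supportedP; rewrite AE.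
  have [w [lt H]] := Hsup u v uv; exists w; rewrite AE; split=> // x.
  by rewrite !AE !ltnS.
have Hab (u v : 'I_n) : [/\ u = v -> A (u * n + v) = 1, u != v -> 1 < A (u * n + v)
    & view (D u v).1 <= A (u * n + v) <= view (D u v).2].
  have pn := entry_lt (ltn_ord u) (ltn_ord v).
  have := HA _ pn; have := Hc _ pn; have [e1 e2] := Hm u v.
  rewrite /consistent /hi /lo diagE e1 e2; case: eqP => uv h /andP[h' _]; split=> //; lia.
pose a (u v : 'I_n) := (A (u * n + v)).-1.
have aE (u v : 'I_n) : A (u * n + v) = (a u v).+1.
  have [h1 h2 _] := Hab u v; rewrite /a.
  by case: (eqVneq u v) => [/h1|/h2]; lia.
have [||| G HG] := @supported_Fo n a.
- by move=> u; have [/(_ erefl) h _ _] := Hab u u; rewrite aE in h; case: h.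
- by move=> u v uv; have [_ /(_ uv) h _] := Hab u v; rewrite aE in h.
- move=> w v wv; have := HA _ (entry_lt (ltn_ord w) (ltn_ord v)).
  rewrite diagE (negPf wv) /= => /andP[_ /supportedP [u []]]; rewrite !aE ltnS => lt H.
  by exists u; split=> // x; have := H x; rewrite !aE !ltnS.
- exists G => u v; rewrite HG view_range -aE; by have [] := Hab u v.
Qed.

(** * The program *)

Local Notation "$ x" := (Var x) (at level 1, format "$ x").
Local Notation "# z" := (Cst z) (at level 1, format "# z").
Local Infix ":+:" := EAdd (at level 50, left associativity).
Local Infix ":-:" := ESub (at level 50, left associativity).
Local Infix ":*:" := EMul (at level 40, left associativity).
Local Infix ":/:" := EDiv (at level 40, left associativity).
Local Notation "c1 ;; c2" := (Seq c1 c2) (at level 60, right associativity).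
Local Notation skip := (Asg 30 #0).

Lemma wp_asg V S x e (Q : state -> Prop) s :
  safe S e s -> eval e s <= V -> Q (setr s x (eval e s)) -> wp V S (Asg x e) Q s.
Proof. by []. Qed.

Lemma wp_sto V S a e (Q : state -> Prop) s :
  safe S a s -> safe S e s -> eval a s < S -> eval e s <= V ->
  Q (setm s (eval a s) (eval e s)) -> wp V S (Sto a e) Q s.
Proof. by []. Qed.

Lemma wp_if V S a b c1 c2 (Q : state -> Prop) s :
  safe S a s -> safe S b s ->
  (eval a s <= eval b s -> wp V S c1 Q (tick s)) ->
  (eval b s < eval a s -> wp V S c2 Q (tick s)) -> wp V S (If a b c1 c2) Q s.
Proof. by move=> sa sb H1 H2; split=> //; case: leqP. Qed.

Lemma wp_seq V S c1 c2 (Q : state -> Prop) s :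
  wp V S c1 (wp V S c2 Q) s -> wp V S (c1 ;; c2) Q s.
Proof. by []. Qed.

Lemma wp_use V S c (Q0 Q : state -> Prop) s : wp V S c Q0 s ->
  (forall s', same c s s' -> Q0 s' -> Q s') -> wp V S c Q s.
Proof. by move=> /wp_frame H HQ; apply: wp_mono H => s' [h1 h2]; apply: HQ. Qed.

Lemma updnE f d z x : updn f d z x = if x == d then z else f x.
Proof. by rewrite /updn eqnE. Qed.

Local Tactic Notation "evm" := cbn [eval safe rg mm ck setr setm tick].
Local Tactic Notation "ev" := cbn [eval safe rg mm ck setr setm tick updn eqn].
Local Tactic Notation "ev" "in" hyp(H) :=
  cbn [eval safe rg mm ck setr setm tick updn eqn] in H.
Local Ltac asg := apply: wp_asg; [by ev | ev | ].
Local Ltac asgl := apply: wp_asg; [by ev | by ev; lia | ].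
Local Ltac asgs := apply: wp_seq; asg.

Lemma iotaS_all (P : pred nat) i : all P (iota 0 i.+1) = all P (iota 0 i) && P i.
Proof. by rewrite -addn1 iotaD all_cat /= andbT. Qed.

Lemma iotaS_has (P : pred nat) i : has P (iota 0 i.+1) = has P (iota 0 i) || P i.
Proof. by rewrite -addn1 iotaD has_cat /= orbF. Qed.

Lemma iotaS_count (P : pred nat) i :
  count P (iota 0 i.+1) = count P (iota 0 i) + P i.
Proof. by rewrite -addn1 iotaD count_cat /= addn0. Qed.

(* Registers: 0 n, 1 n^2, 2 k, 3 2^k, 4 3^k, 5 answer, 6 entry, 7 and 8 bounds,
   9 current time, 10 next time, 11 code, 12 and 13 old and new mask, 14 power
   of 2, 15 quotient, 16 step flag, 17 digit index, 18 digit, 19 vertex u,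
   20 vertex x, 21 and 22 flags, 23 vertex v, 24 row, 25 offset, 26 candidate
   time, 27 and 28 statuses, 29 mask, 30 unused.
   Memory: bounds of entry p at 2p and 2p+1, the undetermined entries from
   2n^2, the statuses from 3n^2, and the two tables from 4n^2 and 4n^2 + 2^k. *)
Definition compat_prog : cmd :=
  Asg 22 #1 ;;
  For 20 $0 (
    Asg 27 (ELd (#3 :*: $1 :+: ($20 :*: $0 :+: $19))) ;;
    Asg 28 (ELd (#3 :*: $1 :+: ($20 :*: $0 :+: $23))) ;;
    If #2 (($27 :-: $28) :+: ($28 :-: $27)) (Asg 22 #0) skip).

Definition support_prog : cmd :=
  Asg 24 ($6 :/: $0) ;;
  Asg 23 ($6 :-: $24 :*: $0) ;;
  Asg 21 #0 ;;
  For 19 $0 (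
    If (ELd (#3 :*: $1 :+: ($24 :*: $0 :+: $19))) #0
      (compat_prog ;; If #1 $22 (Asg 21 #1) skip)
      skip).

Definition new_prog : cmd :=
  For 6 $1 (
    Asg 27 (ELd (#3 :*: $1 :+: $6)) ;;
    If $27 #1
      (If #1 $27 (support_prog ;; If #1 $21 skip (Asg 16 #0)) skip)
      skip).

(** * Checking supports from a status array *)

Section Status.
Variables (V S n : nat) (st : nat -> nat).
Hypothesis V_n : n * n + n + 10 <= V.
Hypothesis S_n : 4 * (n * n) <= S.
Hypothesis st_le : forall q, st q <= 2.

Definition status_state (s : state) : Prop :=
  [/\ rg s 0 = n, rg s 1 = n * n
    & forall q, q < n * n -> mm s (3 * (n * n) + q) = st q].

Lemma wp_compat u v s :
  status_state s -> u < n -> v < n -> rg s 19 = u -> rg s 23 = v ->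
  wp V S compat_prog (fun s' => rg s' 22 = all (compat n st u v) (iota 0 n) /\
    ck s' <= ck s + (6 * n + 3)) s.
Proof.
move=> [s0 s1 sm] un vn su sv; apply: wp_seq; asgl.
apply: (@wp_for V S _ _ _ n (fun i s' =>
  rg s' 22 = all (compat n st u v) (iota 0 i) /\ ck s' <= ck s + (6 * i + 2))).
- by lia.
- by move=> i s' _ [f _] _; split=> //; ev; rewrite f.
- by split=> //; ev; lia.
- move=> i s' iN [f m] xi [g c].
  have e0 : rg s' 0 = n by rewrite f.
  have e1 : rg s' 1 = n * n by rewrite f.
  have e19 : rg s' 19 = u by rewrite f.
  have e23 : rg s' 23 = v by rewrite f.
  have mE q : q < n * n -> mm s' (3 * (n * n) + q) = st q by move=> qn; rewrite m // sm.
  have iu := entry_lt iN un; have iv := entry_lt iN vn.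
  apply: wp_seq; apply: wp_asg; ev; rewrite ?e0 ?e1 ?xi ?e19 ?mE //.
  + by lia.
  + by have := st_le (i * n + u); lia.
  apply: wp_seq; apply: wp_asg; ev; rewrite ?e0 ?e1 ?xi ?e23 ?mE //.
  + by lia.
  + by have := st_le (i * n + v); lia.
  (* Statuses are at most 2, so two of them differ by more than 1 exactly when one is 0 and the
     other 2. *)
  have cE : compat n st u v i =
      (st (i * n + u) - st (i * n + v) + (st (i * n + v) - st (i * n + u)) <= 1).
    by rewrite /compat; have := st_le (i * n + u); have := st_le (i * n + v); lia.
  apply: wp_if => //; ev => h; asgl; ev; rewrite iotaS_all cE ?g; split=> //; split; lia.
- by move=> s' _ _ [g c]; ev; rewrite g; split=> //; lia.
Qed.

Lemma wp_support p s : status_state s -> p < n * n -> rg s 6 = p ->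
  wp V S support_prog (fun s' => rg s' 21 = supported n st p /\
    ck s' <= ck s + (n * (6 * n + 8) + 5)) s.
Proof.
move=> ss pn s6; have [s0 s1 sm] := ss.
have /andP[pd pm] := entry_div pn.
have modE : p - p %/ n * n = p %% n by rewrite {1}(divn_eq p n) addKn.
asgs; rewrite ?s6 ?s0; first by lia.
asgs; rewrite ?s6 ?s0 ?modE; first by lia.
apply: wp_seq; asgl.
set s1' := setr _ 21 _.
pose P0 u := (st (p %/ n * n + u) == 0) && all (compat n st u (p %% n)) (iota 0 n).
apply: (@wp_for V S _ _ _ n (fun i s' =>
  rg s' 21 = has P0 (iota 0 i) /\ ck s' <= ck s + (i * (6 * n + 8) + 4))).
- by lia.
- by move=> i s' _ [f _] _; split=> //; ev; rewrite f.
- by split=> //; rewrite /s1'; ev; lia.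
- move=> i s' iN sm' xi [g c]; have [f m] := sm'.
  have st' : status_state (tick s').
    by rewrite /status_state; ev; rewrite !f // m.
  have [e0 e1 mE] := st'; ev in e0; ev in e1; ev in mE.
  have e24 : rg s' 24 = p %/ n by rewrite f // /s1'; ev; rewrite s6 s0.
  have e23 : rg s' 23 = p %% n by rewrite f // /s1'; ev; rewrite s6 s0 modE.
  have q_lt := entry_lt pd iN.
  apply: wp_if; ev; rewrite ?e0 ?e1 ?e24 ?xi ?mE //; first by lia.
  + move=> le0; apply: wp_seq.
    apply: wp_use (@wp_compat i (p %% n) (tick (tick s')) st' iN pm xi e23) _.
    move=> s2 [f2 m2] [g2 c2]; ev in c2.
    have x2 : rg s2 19 = i by rewrite f2.
    have y2 : rg s2 21 = rg s' 21 by rewrite f2.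
    have P0i : P0 i = all (compat n st i (p %% n)) (iota 0 n).
      by rewrite /P0; case: eqP => // ?; lia.
    apply: wp_if => //; ev; rewrite g2.
      case: all P0i => // P0i _; asgl; ev; rewrite iotaS_has P0i x2 orbT.
      by split=> //; split=> //; clear -c c2; lia.
    case: all P0i => // P0i _; asgl; ev; rewrite iotaS_has P0i x2 y2 g orbF.
    by split=> //; split=> //; clear -c c2; lia.
  + move=> gt0; asgl; ev; split=> //; rewrite iotaS_has g.
    have -> : P0 i = false by rewrite /P0; case: eqP => // ?; lia.
    by rewrite orbF; split=> //; clear -c; lia.
- by move=> s' _ _ [g c]; ev; rewrite g; split=> //; lia.
Qed.

(** The quadratic check runs only for entries of status 1; the bound counts these instead of
    charging every entry, as the total time requires. *)
Lemma wp_new (b : bool) s : status_state s -> rg s 16 = b ->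
  wp V S new_prog (fun s' =>
    rg s' 16 = b && all (fun p => (st p == 1) ==> supported n st p) (iota 0 (n * n)) /\
    ck s' <= ck s + (7 * (n * n) + count (fun p => st p == 1) (iota 0 (n * n))
                      * (n * (6 * n + 8) + 5) + 2)) s.
Proof.
move=> ss s16; have [s0 s1 sm] := ss.
have [X XE] : exists X, X = n * (6 * n + 8) + 5 by eexists.
rewrite -XE.
apply: (@wp_for V S _ _ _ (n * n) (fun i s' =>
  rg s' 16 = b && all (fun p => (st p == 1) ==> supported n st p) (iota 0 i) /\
  ck s' <= ck s + (7 * i + count (fun p => st p == 1) (iota 0 i) * X + 1))).
- by lia.
- by move=> i s' _ [f _] _; split=> //; ev; rewrite f.
- by split; ev; rewrite /= ?andbT //; lia.
- move=> i s' iN sm' xi [g c]; have [f m] := sm'.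
  have st' : status_state (tick s').
    by rewrite /status_state; ev; rewrite !f // m.
  have [e0 e1 mE] := st'; ev in e0; ev in e1; ev in mE.
  apply: wp_seq; apply: wp_asg; ev; rewrite ?e1 ?xi ?mE //; first by lia.
    by have := st_le i; lia.
  have cS : count (fun p => st p == 1) (iota 0 i.+1) =
      count (fun p => st p == 1) (iota 0 i) + (st i == 1).
    by rewrite iotaS_count.
  have aS : all (fun p => (st p == 1) ==> supported n st p) (iota 0 i.+1) =
      all (fun p => (st p == 1) ==> supported n st p) (iota 0 i) &&
      ((st i == 1) ==> supported n st i) by rewrite iotaS_all.
  move: c cS aS; set k0 := count _ (iota 0 i); set k1 := count _ _.
  set a0 := all _ (iota 0 i); set a1 := all _ _ => c cS aS.
  have skipE : (st i == 1) = false -> a1 = a0 /\ k1 = k0.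
    by move=> e; rewrite aS cS e /= andbT addn0.
  apply: wp_if => //; ev => h1; last first.
    have [-> ->] : a1 = a0 /\ k1 = k0 by apply: skipE; clear -h1; lia.
    by asgl; ev; rewrite g xi; split=> //; split=> //; clear -c; lia.
  apply: wp_if => //; ev => h2; last first.
    have [-> ->] : a1 = a0 /\ k1 = k0 by apply: skipE; clear -h1 h2; lia.
    by asgl; ev; rewrite g xi; split=> //; split=> //; clear -c; lia.
  have sti : st i = 1 by lia.
  apply: wp_seq.
  set s2 := tick (tick _).
  have ss2 : status_state s2 by [].
  have s26 : rg s2 6 = i by rewrite -xi.
  apply: wp_use (wp_support ss2 iN s26) _ => s3 [f3 m3] [g3 c3]; rewrite /s2 in c3; ev in c3.
  have x3 : rg s3 6 = i by rewrite f3.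
  have y3 : rg s3 16 = rg s' 16 by rewrite f3.
  have kE : k1 = k0.+1 by rewrite cS sti addn1.
  have aE : a1 = a0 && supported n st i by rewrite aS sti.
  rewrite -XE in c3; rewrite kE aE mulSn; apply: wp_if => //; ev; rewrite g3.
    case: (supported n st i) => // _; asgl; ev; rewrite y3 g x3 !andbT.
    by split=> //; split=> //; clear -c c3; lia.
  case: (supported n st i) => // _; asgl; ev; rewrite x3 !andbF.
  by split=> //; split=> //; clear -c c3; lia.
- by move=> s' _ _ [g c]; ev; rewrite g; split=> //; lia.
Qed.

End Status.

(* Truncated subtraction replaces branching: [1 - (1 - x)] is [min x 1]. *)
Definition fill_prog : cmd :=
  For 6 $1 (
    Sto (#3 :*: $1 :+: $6)
      ((#1 :-: ($9 :-: ELd (#2 :*: $6)))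
       :+: (#1 :-: (#1 :-: (ELd (#2 :*: $6) :-: $9))))).

(** For a digit [d], the factor [1 - d] selects 0 (old mask) and [1 - (d - 1)] selects 0 and 1 (new
    mask), so their difference selects 1. Its product with the distance of the time from the range
    is positive exactly when a new entry lies outside its range. *)
Definition digits_prog : cmd :=
  For 17 $2 (
    Asg 6 (ELd (#2 :*: $1 :+: $17)) ;;
    Asg 27 ($15 :/: #3) ;;
    Asg 18 ($15 :-: $27 :*: #3) ;;
    Asg 15 $27 ;;
    Sto (#3 :*: $1 :+: $6) $18 ;;
    Asg 12 ($12 :+: $14 :*: (#1 :-: $18)) ;;
    Asg 13 ($13 :+: $14 :*: (#1 :-: ($18 :-: #1))) ;;
    If (((#1 :-: ($18 :-: #1)) :-: (#1 :-: $18)) :*: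
          ((ELd (#2 :*: $6) :-: $9) :+: ($9 :-: ELd (#2 :*: $6 :+: #1)))) #0
      skip (Asg 16 #0) ;;
    Asg 14 ($14 :*: #2)).

Definition decode_prog : cmd :=
  fill_prog ;; Asg 12 #0 ;; Asg 13 #0 ;; Asg 14 #1 ;; Asg 15 $11 ;; Asg 16 #1 ;;
  digits_prog.

Definition step_prog : cmd :=
  decode_prog ;; new_prog ;;
  If #1 ($16 :*: ELd (#4 :*: $1 :+: $12))
    (Sto (#4 :*: $1 :+: $3 :+: $13) #1) skip.

(** Transitions read the first table and write the second, so a bit set in a round is never taken
    for an old mask in the same round. *)
Definition round_prog : cmd :=
  For 29 $3 (Sto (#4 :*: $1 :+: $3 :+: $29) #0) ;;
  For 11 $4 step_prog ;;
  For 29 $3 (Sto (#4 :*: $1 :+: $29) (ELd (#4 :*: $1 :+: $3 :+: $29))).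

(** * Processing one code *)

Section Core.
Variables (V S n : nat) (L R : nat -> nat).
Let nn := n * n.
Let E := undets n L R.
Let k := size E.
Hypothesis V_n : n * n + n + 10 <= V.
Hypothesis V_k : 2 ^ k + 3 ^ k <= V.
Hypothesis S_n : 4 * nn + 2 * 2 ^ k <= S.

Definition core (s : state) : Prop :=
  [/\ [/\ rg s 0 = n, rg s 1 = nn, rg s 2 = k, rg s 3 = 2 ^ k & rg s 4 = 3 ^ k],
      forall p, p < nn -> mm s (2 * p) = L p /\ mm s (2 * p + 1) = R p
    & forall i, i < k -> mm s (2 * nn + i) = nth 0 E i].

Lemma k_le : k <= nn.
Proof. by rewrite /k /E /undets size_filter -[nn in X in _ <= X](size_iota 0) count_size. Qed.

Lemma core_frame s s' : (forall x, x <= 4 -> rg s' x = rg s x) ->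
  (forall a, a < 3 * nn -> mm s' a = mm s a) -> core s -> core s'.
Proof.
move=> Hr Hm [[h0 h1 h2 h3 h4] hL hE]; have kn := k_le; split.
- by rewrite !Hr.
- by move=> p pn; rewrite !Hm; [exact: hL|clear -pn; lia|clear -pn; lia].
- by move=> i ik; rewrite Hm ?hE //; clear -ik kn; lia.
Qed.

Definition outside (s s' : state) : Prop :=
  forall a, (a < 3 * nn) || (4 * nn <= a) -> mm s' a = mm s a.

Lemma wp_fill t s : core s -> rg s 9 = t ->
  wp V S fill_prog (fun s' => [/\ forall q, q < nn -> mm s' (3 * nn + q) = rel3 L t q,
    outside s s' & ck s' <= ck s + (3 * nn + 2)]) s.
Proof.
move=> [[h0 h1 h2 h3 h4] hL hE] h9.
apply: (@wp_for V S _ _ _ nn (fun i s' =>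
  [/\ forall q, q < i -> mm s' (3 * nn + q) = rel3 L t q,
    outside s s' & ck s' <= ck s + (3 * i + 1)])).
- by rewrite /nn; lia.
- by move=> i s' _ [f _] _; split=> //; ev; rewrite f.
- by split=> //; ev; lia.
- move=> i s' iN [f m] xi [g o c].
  have e1 : rg s' 1 = nn by rewrite f.
  have e9 : rg s' 9 = t by rewrite f.
  have mi : mm s' (2 * i) = L i by rewrite o ?(hL i iN).1 //; lia.
  apply: wp_sto; ev; rewrite ?e1 ?e9 ?xi ?mi //; try lia.
  have -> : 1 - (t - L i) + (1 - (1 - (L i - t))) = rel3 L t i.
    by rewrite /rel3; do 2? [case: ifP => ?]; lia.
  split=> //; split.
  + move=> q; rewrite ltnS => qi; evm; rewrite updnE eqn_add2l.
    by case: eqP => [->|ne] //; apply: g; lia.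
  + move=> a ha; evm; rewrite updnE; case: eqP => [e|_]; last exact: o.
    by move: ha; rewrite e; lia.
  + by ev; lia.
- by move=> s' _ _ [g o c]; split=> //; ev; lia.
Qed.

Definition old_mask c := cod 2 (fun i => dig c i == 0) k.
Definition new_mask c := cod 2 (fun i => dig c i <= 1) k.

Lemma old_mask_lt c : old_mask c < 2 ^ k.
Proof. by apply: cod_lt => i _; rewrite ltnS leq_b1. Qed.

Lemma new_mask_lt c : new_mask c < 2 ^ k.
Proof. by apply: cod_lt => i _; rewrite ltnS leq_b1. Qed.

Lemma cod2_le (f : nat -> bool) i : i <= k -> cod 2 f i < 2 ^ k.
Proof.
move=> ik; apply: (@leq_trans (2 ^ i)); last by rewrite leq_pexp2l.
by apply: cod_lt => j _; case: (f j).
Qed.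

Lemma wp_digits t c s : core s -> rg s 9 = t -> c < 3 ^ k ->
  (forall q, q < nn -> mm s (3 * nn + q) = rel3 L t q) ->
  rg s 12 = 0 -> rg s 13 = 0 -> rg s 14 = 1 -> rg s 15 = c -> rg s 16 = 1 ->
  wp V S digits_prog (fun s' =>
    [/\ forall q, q < nn -> mm s' (3 * nn + q) = stat n L R t c q,
        outside s s', rg s' 12 = old_mask c /\ rg s' 13 = new_mask c,
        rg s' 16 = in_window n L R t c & ck s' <= ck s + (12 * k + 2)]) s.
Proof.
move=> [[h0 h1 h2 h3 h4] hL hE] h9 ck3 hst h12 h13 h14 h15 h16; have kn := k_le.
pose win i := (dig c i == 1) ==> (L (nth 0 E i) <= t <= R (nth 0 E i)).
have k2 : k < 2 ^ k by apply: ltn_expl.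
have nV : nn + n + 10 <= V := V_n.
apply: (@wp_for V S _ _ _ k (fun i s' =>
  [/\ [/\ forall q, q < nn -> mm s' (3 * nn + q) =
          if undet L R q && (index q E < i) then dig c (index q E) else rel3 L t q
        & outside s s'],
      rg s' 12 = cod 2 (fun i => dig c i == 0) i /\
      rg s' 13 = cod 2 (fun i => dig c i <= 1) i,
      rg s' 14 = 2 ^ i /\ rg s' 15 = c %/ 3 ^ i,
      rg s' 16 = all win (iota 0 i) & ck s' <= ck s + (12 * i + 1)])).
- by lia.
- by move=> i s' _ [f _] _; split=> //; ev; rewrite f.
- split; ev => //; rewrite ?h12 ?h13 ?h14 ?h15 ?h16 /cod ?big_ord0 ?expn0 ?divn1 //.
    by split=> // q qn; rewrite ltn0 andbF hst.
  by lia.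
- move=> i s' ik [f m] xi [[g o] [e12 e13] [e14 e15] e16 c'].
  have e1 : rg s' 1 = nn by rewrite f.
  have e9 : rg s' 9 = t by rewrite f.
  have mE : mm s' (2 * nn + i) = nth 0 E i by rewrite o ?hE //; lia.
  have [pn pu] : nth 0 E i < nn /\ undet L R (nth 0 E i) := nth_undets ik.
  have [p pE] : exists p, nth 0 E i = p by eexists.
  rewrite pE in pn pu mE.
  have mL : mm s' (2 * p) = L p by rewrite o ?(hL p pn).1 //; lia.
  have mR : mm s' (2 * p + 1) = R p by rewrite o ?(hL p pn).2 //; lia.
  have c3 : c %/ 3 ^ i <= V by apply: leq_trans (leq_div _ _) _; lia.
  have dE : c %/ 3 ^ i - c %/ 3 ^ i %/ 3 * 3 = dig c i.
    by rewrite {1}(divn_eq (c %/ 3 ^ i) 3) addKn.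
  have d3 := dig_lt c i.
  have q3 : c %/ 3 ^ i %/ 3 <= V by apply: leq_trans (leq_div _ _) _.
  have p2 : 2 ^ i.+1 <= 2 ^ k by rewrite leq_pexp2l.
  have o12 := @cod2_le (fun i => dig c i == 0) i.+1 ik.
  have o13 := @cod2_le (fun i => dig c i <= 1) i.+1 ik.
  have w12 : (dig c i == 0 : nat) = 1 - dig c i by clear -d3; lia.
  have w13 : (dig c i <= 1 : nat) = 1 - (dig c i - 1) by clear -d3; lia.
  rewrite codS w12 mulnC in o12; rewrite codS w13 mulnC in o13.
  apply: wp_seq; apply: wp_asg; ev; rewrite ?e1 ?xi ?mE //; try (clear -ik kn S_n pn nV; lia).
  apply: wp_seq; apply: wp_asg; ev; rewrite ?e15 //.
  apply: wp_seq; apply: wp_asg; ev; rewrite ?e15 ?dE //; first by clear -d3 V_n; lia.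
  apply: wp_seq; apply: wp_asg; ev; rewrite ?e15 //.
  apply: wp_seq; apply: wp_sto; ev; rewrite ?e1 ?e15 ?dE //; try (clear -S_n pn d3 V_n; lia).
  apply: wp_seq; apply: wp_asg; ev; rewrite ?e12 ?e14 //; first by clear -o12 V_k; lia.
  apply: wp_seq; apply: wp_asg; ev; rewrite ?e13 ?e14 //; first by clear -o13 V_k; lia.
  have winE : win i = ((1 - (dig c i - 1) - (1 - dig c i)) * (L p - t + (t - R p)) <= 0).
    rewrite /win pE; clear -d3; case: (dig c i) d3 => [|[|[|]]] //= _.
    by rewrite mul1n; lia.
  (* Both outcomes of the range test continue with the same assignment; the invariant is restored
     once for both. *)
  have fin s2 : rg s2 12 = cod 2 (fun i => dig c i == 0) i + 2 ^ i * (1 - dig c i) ->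
      rg s2 13 = cod 2 (fun i => dig c i <= 1) i + 2 ^ i * (1 - (dig c i - 1)) ->
      rg s2 14 = 2 ^ i -> rg s2 15 = c %/ 3 ^ i %/ 3 -> rg s2 17 = i ->
      rg s2 16 = all win (iota 0 i) && win i ->
      mm s2 = updn (mm s') (3 * nn + p) (dig c i) -> ck s2 <= ck s' + 10 ->
      wp V S (Asg 14 ($14 :*: #2)) (fun s2 => rg s2 17 = i /\
        [/\ [/\ forall q, q < nn -> mm (setr s2 17 i.+1) (3 * nn + q) =
            if undet L R q && (index q E < i.+1) then dig c (index q E) else rel3 L t q
          & outside s (setr s2 17 i.+1)],
          rg (setr s2 17 i.+1) 12 = cod 2 (fun i => dig c i == 0) i.+1 /\
          rg (setr s2 17 i.+1) 13 = cod 2 (fun i => dig c i <= 1) i.+1,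
          rg (setr s2 17 i.+1) 14 = 2 ^ i.+1 /\ rg (setr s2 17 i.+1) 15 = c %/ 3 ^ i.+1,
          rg (setr s2 17 i.+1) 16 = all win (iota 0 i.+1)
        & ck (setr s2 17 i.+1) <= ck s + (12 * i.+1 + 1)]) s2.
    move=> a12 a13 a14 a15 a17 a16 am ac.
    apply: wp_asg; ev; rewrite ?a14 -?expnSr //; first by clear -p2 V_k; lia.
    rewrite a12 a13 a15 a16 a17 !codS w12 w13 -divnMA -expnSr iotaS_all.
    rewrite ![_ * 2 ^ i]mulnC.
    split=> //; split=> //; last by clear -c' ac; lia.
    split=> [q qn|a ha]; evm; rewrite am updnE; last first.
      case: eqP => [e|_]; last exact: o.
      by clear -ha e pn; move: ha; rewrite e; lia.
    rewrite eqn_add2l; case: eqP => [->|ne].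
      by rewrite pu -pE index_uniq ?undets_uniq // ltnSn.
    rewrite g //; case: (boolP (undet L R q)) => //= qu.
    have [qk qE] := index_undets qn qu.
    case: (eqVneq (index q E) i) => [e|ne']; first by case: ne; rewrite -qE e pE.
    by have -> : (index q E < i.+1) = (index q E < i) by clear -ne'; lia.
  have uL d : updn (mm s') (3 * nn + p) d (2 * p) = L p.
    by rewrite updnE mL ifF //; clear -pn; lia.
  have uR d : updn (mm s') (3 * nn + p) d (2 * p + 1) = R p.
    by rewrite updnE mR ifF //; clear -pn; lia.
  apply: wp_seq; apply: wp_if.
  + by ev; rewrite ?mL ?mR; clear -S_n pn; repeat split; lia.
  + by [].
  + ev; rewrite uL uR e9 => h.
    have wi : win i by rewrite winE.
    asgl; apply: fin; ev; rewrite ?e12 ?e13 ?e14 ?e15 ?e16 ?dE ?wi ?andbT //.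
    by clear; lia.
  + ev; rewrite uL uR e9 => h.
    have wi : win i = false by rewrite winE leqNgt h.
    asgl; apply: fin; ev; rewrite ?e12 ?e13 ?e14 ?e15 ?e16 ?dE ?wi ?andbF //.
    by clear; lia.
- move=> s' _ _ [[g o] e12 _ e16 c']; ev; split=> //; last by clear -c'; lia.
  move=> q qn; rewrite g // /stat.
  case: (boolP (undet L R q)) => //= qu.
  by have [qk _] := index_undets qn qu; rewrite qk.
Qed.

Lemma wp_decode t c s : core s -> rg s 9 = t -> rg s 11 = c -> c < 3 ^ k ->
  wp V S decode_prog (fun s' =>
    [/\ forall q, q < nn -> mm s' (3 * nn + q) = stat n L R t c q,
        outside s s', rg s' 12 = old_mask c /\ rg s' 13 = new_mask c,
        rg s' 16 = in_window n L R t c & ck s' <= ck s + (3 * nn + 12 * k + 9)]) s.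
Proof.
move=> cs h9 h11 c3.
apply: wp_seq; apply: wp_use (wp_fill cs h9) _ => s1 [f1 _] [g1 o1 c1].
have cs1 : core s1.
  by apply: core_frame cs => [[|[|[|[|[|]]]]] // _|a ha]; rewrite ?f1 ?o1 ?ha.
have e9 : rg s1 9 = t by rewrite f1.
have e11 : rg s1 11 = c by rewrite f1.
apply: wp_seq; asgl; apply: wp_seq; asgl; apply: wp_seq; asgl; apply: wp_seq.
apply: wp_asg; ev => //; first by rewrite e11; clear -c3 V_k; lia.
apply: wp_seq; asgl.
set s2 := setr _ 16 _.
have cs2 : core s2 by apply: core_frame cs1 => [[|[|[|[|[|]]]]]|].
have := @wp_digits t c s2 cs2 e9 c3 g1 erefl erefl erefl e11 erefl.
apply: wp_mono => s' [h1 h2 h3 h4 h5]; split=> //.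
  by move=> a ha; rewrite h2 //; apply: o1.
by move: h5; rewrite /s2; ev; clear -c1; lia.
Qed.

Definition det_count t := count (fun p => ~~ undet L R p && (L p == t)) (iota 0 nn).

Lemma count_stat t c :
  count (fun p => stat n L R t c p == 1) (iota 0 nn) <= det_count t + k.
Proof.
have -> : k = count (undet L R) (iota 0 nn) by rewrite /k /E /undets size_filter.
rewrite /det_count; elim: (iota 0 nn) => //= p l IH.
have : (stat n L R t c p == 1) <= (~~ undet L R p && (L p == t)) + undet L R p.
  rewrite /stat /rel3; case: (undet L R p) => /=; first by rewrite leq_b1.
  rewrite addn0; case: (ltnP (L p) t) => //= h1; case: (leqP (L p) t) => //= h2.
  by have -> : L p = t; [clear -h1 h2; lia|rewrite eqxx].
by move: IH; clear; lia.
Qed.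

(** Of the [10 * nn] ticks, 3 per entry fill the statuses and 7 per entry scan for status 1. *)
Definition step_cost t := (10 * nn + 12 * k + (det_count t + k) * (n * (6 * n + 8) + 5) + 13).

Lemma wp_step t c s : core s -> rg s 9 = t -> rg s 11 = c -> c < 3 ^ k ->
  mm s (4 * nn + old_mask c) <= 1 ->
  wp V S step_prog (fun s' => [/\ 
    forall a, (a < 3 * nn) || (4 * nn <= a) -> mm s' a =
      if [&& in_window n L R t c, new_supported n L R t c,
             mm s (4 * nn + old_mask c) == 1 & a == 4 * nn + 2 ^ k + new_mask c]
      then 1 else mm s a
    & ck s' <= ck s + step_cost t]) s.
Proof.
move=> cs h9 h11 c3 hb; have nV : nn + n + 10 <= V := V_n.
have om := old_mask_lt c; have nm := new_mask_lt c.
apply: wp_seq; apply: wp_use (wp_decode cs h9 h11 c3) _.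
move=> s1 [f1 _] [g1 o1 [e12 e13] e16 c1].
have cs1 : core s1.
  by apply: core_frame cs => [[|[|[|[|[|]]]]] // _|a ha]; rewrite ?f1 ?o1 ?ha.
have [[a0 a1 _ a3 _] _ _] := cs1.
have st_le q : stat n L R t c q <= 2.
  by rewrite /stat /rel3; case: ifP => _; [have := dig_lt c (index q E)|do 2? case: ifP].
have S4 : 4 * (n * n) <= S by apply: leq_trans S_n; apply: leq_addr.
have ss1 : status_state n (stat n L R t c) s1 by [].
apply: wp_seq; apply: wp_use (wp_new V_n S4 st_le ss1 e16) _.
move=> s2 [f2 m2] [e16' c2].
have b1 : rg s2 1 = nn by rewrite f2.
have b3 : rg s2 3 = 2 ^ k by rewrite f2.
have b12 : rg s2 12 = old_mask c by rewrite f2.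
have b13 : rg s2 13 = new_mask c by rewrite f2.
have bm : mm s2 (4 * nn + old_mask c) = mm s (4 * nn + old_mask c).
  by rewrite m2 // o1 // leq_addr orbT.
have mo a : (a < 3 * nn) || (4 * nn <= a) -> mm s2 a = mm s a.
  by move=> ha; rewrite m2 // o1.
have cost : ck s2 + 2 <= ck s + step_cost t.
  have := leq_mul (count_stat t c) (leqnn (n * (6 * n + 8) + 5)).
  by move: c1 c2; rewrite /step_cost -/nn; clear; lia.
apply: wp_if; ev; rewrite ?b1 ?b12 //.
- by clear -om S_n; split=> //; split=> //; lia.
- rewrite bm e16' -/nn => h.
  apply: wp_sto; ev; rewrite ?b1 ?b3 ?b13 //; try (clear -nm S_n nV; lia).
  split; last by ev; clear -cost; lia.
  move=> a ha; evm; rewrite updnE (mo a ha) -/(new_supported n L R t c).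
  have [-> -> ->] : [/\ in_window n L R t c, new_supported n L R t c
      & mm s (4 * nn + old_mask c) == 1].
    move: h; rewrite -/(new_supported n L R t c).
    by case: in_window; case: new_supported => //=; split=> //; clear -h hb; lia.
  by [].
- rewrite bm e16' -/nn => h; asgl; ev; split; last by ev; clear -cost; lia.
  move=> a ha; rewrite (mo a ha); case: and4P => // -[h1 h2 /eqP h3 _].
  move: h; rewrite -/(new_supported n L R t c) h1 h2 h3 /= ; clear; lia.
Qed.
End Core.

(** * One round over all codes *)

Section Rounds.
Variables (V S n : nat) (L R : nat -> nat).
Let nn := n * n.
Let k := size (undets n L R).
Hypothesis V_n : n * n + n + 10 <= V.
Hypothesis V_k : 2 ^ k + 3 ^ k <= V.
Hypothesis S_n : 4 * nn + 2 * 2 ^ k <= S.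
Hypothesis diag1 : forall p, p < nn -> diag n p -> L p = 1 /\ R p = 1.

(** Quantifying over functions is harmless: both the index [cod 2 f k] and [reachable] see only the
    first [k] bits of [f]. *)
Definition table (s : state) (t : nat) : Prop := forall f : nat -> bool,
  mm s (4 * nn + cod 2 f k) = `[< reachable n L R t f >].

Definition round_cost t :=
  3 ^ k * (step_cost n L R t + 2) + 6 * 2 ^ k + 6.

Lemma wp_round t t' s : core n L R s -> rg s 9 = t' -> table s t ->
  0 < t -> t < t' -> t' \in times n L R ->
  (forall x, x \in times n L R -> t < x -> t' <= x) ->
  wp V S round_prog (fun s' => [/\ core n L R s', table s' t'
    & ck s' <= ck s + round_cost t']) s.
Proof.
move=> cs h9 tab t0 tt' t'T gap; have nV : nn + n + 10 <= V := V_n.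
have [[_ h1 _ h3 h4] _ _] := cs; rewrite -/nn -/k in h1 h3 h4.
have [pk pkE] : exists pk, 2 ^ k = pk by eexists.
have Vpk : pk + 3 ^ k <= V by rewrite -pkE.
have Spk : 4 * nn + 2 * pk <= S by rewrite -pkE.
rewrite pkE in h3.
apply: wp_seq; apply: (@wp_use _ _ _ (fun s' =>
  [/\ forall m, m < pk -> mm s' (4 * nn + pk + m) = 0,
      forall a, a < 4 * nn + pk -> mm s' a = mm s a & ck s' <= ck s + (3 * pk + 2)])).
  apply: (@wp_for V S _ _ _ pk (fun i s' =>
    [/\ forall m, m < i -> mm s' (4 * nn + pk + m) = 0,
      forall a, a < 4 * nn + pk -> mm s' a = mm s a & ck s' <= ck s + (3 * i + 1)])).
  - by clear -Vpk; lia.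
  - by move=> i s' _ [f _] _; split=> //; ev; rewrite f.
  - by split=> //; ev; clear; lia.
  - move=> i s' ip [f _] xi [g o c].
    have e1 : rg s' 1 = nn by rewrite f.
    have e3 : rg s' 3 = pk by rewrite f.
    apply: wp_sto; ev; rewrite ?e1 ?e3 ?xi //; first by clear -ip Spk; lia.
    split=> //; split; evm.
    + move=> m; rewrite ltnS updnE eqn_add2l => mi; case: eqP => // ne.
      by apply: g; clear -mi ne; lia.
    + by move=> a ha; rewrite updnE ifF ?o //; clear -ha; lia.
    + by clear -c; lia.
  - by move=> s' _ _ [g o c]; ev; split=> //; clear -c; lia.
move=> s1 [f1 _] [z1 o1 c1].
have cs1 : core n L R s1.
  apply: core_frame cs => [[|[|[|[|[|]]]]] // _|a ha]; rewrite ?f1 ?o1 //.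
  by rewrite -/nn in ha; clear -ha; lia.
(* The condition under which code [c] sets bit [m] of the second table. *)
pose hit m c := [&& in_window n L R t' c, new_supported n L R t' c,
  mm s (4 * nn + old_mask n L R c) == 1 & m == new_mask n L R c].
have [sc scE] : exists sc, step_cost n L R t' = sc by eexists.
apply: wp_seq; apply: (@wp_use _ _ _ (fun s' =>
  [/\ forall m, m < pk -> mm s' (4 * nn + pk + m) = has (hit m) (iota 0 (3 ^ k)),
      forall a, (a < 3 * nn) || (4 * nn <= a < 4 * nn + pk) -> mm s' a = mm s a
    & ck s' <= ck s1 + ((3 ^ k) * (sc + 2) + 2)])).
  apply: (@wp_for V S _ _ _ (3 ^ k) (fun i s' =>
  [/\ forall m, m < pk -> mm s' (4 * nn + pk + m) = has (hit m) (iota 0 i),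
      forall a, (a < 3 * nn) || (4 * nn <= a < 4 * nn + pk) -> mm s' a = mm s a
    & ck s' <= ck s1 + (i * (sc + 2) + 1)])).
  - by clear -Vpk; lia.
  - by move=> i s' _ [f _] _; split=> //; ev; rewrite f // f1.
  - split; evm; last by clear; lia.
      by move=> m mp; rewrite z1.
    by move=> a ha; apply: o1; clear -ha; lia.
  - move=> i s' i3 [f _] xi [g o c].
    have cs' : core n L R (tick s').
      apply: core_frame cs => [[|[|[|[|[|]]]]] // _|a ha]; evm; rewrite ?f ?f1 ?o //.
      by rewrite ha.
    have e9 : rg (tick s') 9 = t' by ev; rewrite f // f1.
    have om : old_mask n L R i < pk by rewrite -pkE; apply: old_mask_lt.
    have nm : new_mask n L R i < pk by rewrite -pkE; apply: new_mask_lt.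
    have mo : mm s' (4 * nn + old_mask n L R i) = mm s (4 * nn + old_mask n L R i).
      by apply: o; clear -om; lia.
    have lb : mm (tick s') (4 * nn + old_mask n L R i) <= 1.
      by evm; rewrite mo tab leq_b1.
    apply: wp_use (wp_step V_n V_k S_n cs' e9 xi i3 lb) _ => s2 [f2 _] [].
    rewrite scE -/nn -/k pkE; evm; rewrite mo => g2 c2.
    have x2 : rg s2 11 = i by rewrite f2.
    split=> //; split; evm.
    + move=> m mp; rewrite iotaS_has g2; last by clear; lia.
      rewrite eqn_add2l g // /hit.
      case: (in_window n L R t' i) => /=; last by rewrite orbF.
      case: (new_supported n L R t' i) => /=; last by rewrite orbF.
      case: (mm s _ == 1) => /=; last by rewrite orbF.
      by case: (m == _); rewrite ?orbF ?orbT.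
    + move=> a ha; rewrite g2 ?o //; last by clear -ha; lia.
      by case: and4P => // -[_ _ _ /eqP e]; clear -ha e; lia.
    + by clear -c c2; lia.
  - by move=> s' _ _ [g o c]; ev; split=> //; clear -c; lia.
move=> s2 [f2 _] [g2 o2 c2].
have core2 s' : (forall x, x <= 4 -> rg s' x = rg s2 x) ->
    (forall a, a < 3 * nn -> mm s' a = mm s2 a) -> core n L R s'.
  move=> Hr Hm; apply: core_frame cs => [[|[|[|[|[|]]]]] // _|a ha].
  1-5: by rewrite Hr // f2 // f1.
  by rewrite Hm // o2 // ha.
apply: (@wp_for V S _ _ _ pk (fun i s' =>
  [/\ forall m, m < i -> mm s' (4 * nn + m) = mm s2 (4 * nn + pk + m),
      forall a, (a < 4 * nn) || (4 * nn + pk <= a) -> mm s' a = mm s2 a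
    & ck s' <= ck s2 + (3 * i + 1)])).
- by clear -Vpk; lia.
- by move=> i s' _ [f _] _; split=> //; ev; rewrite f // f2 // f1.
- by split=> //; ev; clear; lia.
- move=> i s' ip [f _] xi [g o c].
  have e1 : rg s' 1 = nn by rewrite f // f2 // f1.
  have e3 : rg s' 3 = pk by rewrite f // f2 // f1.
  have mi : mm s' (4 * nn + pk + i) = mm s2 (4 * nn + pk + i).
    by apply: o; clear; lia.
  apply: wp_sto; ev; rewrite ?e1 ?e3 ?xi ?mi //; try (clear -ip Spk; lia).
    by rewrite g2 //; apply: leq_trans (leq_b1 _) _; clear -nV; lia.
  split=> //; split; evm.
  + move=> m; rewrite ltnS updnE eqn_add2l => mi'; case: eqP => [-> //|ne].
    by apply: g; clear -mi' ne; lia.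
  + by move=> a ha; rewrite updnE ifF ?o //; clear -ha ip; lia.
  + by clear -c; lia.
- move=> s' [f _] _ [g o c]; split.
  + apply: core2 => [x x4|a ha]; evm.
      by rewrite f //; case: x x4 => [|[|[|[|[|]]]]].
    by apply: o; clear -ha; lia.
  + move=> fm; evm.
    have fb : cod 2 fm k < pk by rewrite -pkE; apply: cod_lt => i _; rewrite ltnS leq_b1.
    rewrite g // g2 //; congr nat_of_bool; apply/idP/idP => [/hasP|/asboolP].
      case=> cc; rewrite mem_iota add0n => /= c3 /and4P[w1 w2 w3 /eqP w4].
      apply/asboolP/(reachable_step diag1 _ t0 tt' t'T gap).
      exists cc; split=> //; first by rewrite w1.
        by move: w3; rewrite /old_mask tab; case: asboolP.
      move=> i ik.
      (* The program compares indices, [reachable_step] compares masks bit by bit; injectivity of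
         the binary code links the two. *)
      have e : (fm i : nat) = (dig cc i <= 1).
        apply: (@cod_inj 2 (fun i => fm i) (fun i => dig cc i <= 1) k _ _ w4 i ik);
          by move=> j _; rewrite ltnS leq_b1.
      by move: e; case: (fm i); case: (dig cc i <= 1).
    case/(reachable_step diag1 _ t0 tt' t'T gap)=> cc [c3 /andP[w1 w2] w3 w4].
    apply/hasP; exists cc; first by rewrite mem_iota.
    rewrite /hit w1 w2 /= /old_mask tab; apply/andP; split.
      by rewrite eqb1; apply/asboolP.
    by apply/eqP/eq_cod => i ik; rewrite w4.
  + by evm; rewrite /round_cost scE pkE; clear -c c1 c2; lia.
Qed.

End Rounds.

Definition next_prog : cmd :=
  Asg 10 #0 ;;
  For 6 $1 (
    Asg 7 (ELd (#2 :*: $6)) ;;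
    For 25 ($2 :+: #1) (
      Asg 26 ($7 :+: $25) ;;
      If ($9 :+: #1) $26
        (If $10 #0 (Asg 10 $26) (If $26 $10 (Asg 10 $26) skip))
        skip)).

Definition main_prog : cmd :=
  next_prog ;; While #0 $10 (Asg 9 $10 ;; round_prog ;; next_prog).

(* 0 stands for the absence of a later candidate. *)
Definition best (t : nat) (P : nat -> Prop) (b : nat) : Prop :=
  (b = 0 /\ forall x, P x -> x <= t) \/
  [/\ P b, t < b & forall x, P x -> t < x -> b <= x].

Lemma eq_best t (P P' : nat -> Prop) b :
  (forall x, P x <-> P' x) -> best t P b -> best t P' b.
Proof.
move=> PP' [[-> H]|[H1 H2 H3]]; [left|right]; split=> //.
- by move=> x /PP'; apply: H.
- exact/PP'.
- by move=> x /PP'; apply: H3.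
Qed.

Lemma best_add t (P : nat -> Prop) b y b' : best t P b ->
  b' = (if (t < y) && ((b == 0) || (y <= b)) then y else b) ->
  best t (fun x => P x \/ x = y) b'.
Proof.
move=> Hb ->; case: ifP => [/andP[ty hy]|hy].
  right; split=> //; first by right.
  move=> x [Px|-> //] tx; case: Hb => [[b0 H]|[H1 H2 H3]].
    by have := H x Px; lia.
  by have := H3 x Px tx; lia.
case: Hb => [[b0 H]|[H1 H2 H3]]; [left|right]; split=> //.
- by move=> x [/H //|->]; move: hy; rewrite b0; lia.
- by left.
- by move=> x [Px|->] tx; [exact: H3|lia].
Qed.

Lemma wloop_mono S a b F (Q Q' : state -> Prop) f s :
  (forall (P P' : state -> Prop) s', (forall s2, P s2 -> P' s2) -> F P s' -> F P' s') ->
  (forall s', Q s' -> Q' s') -> wloop S a b F Q f s -> wloop S a b F Q' f s.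
Proof.
move=> HF QQ; elim: f s => [|f IH] s /= [h1 h2]; case: ifP => // _.
- by move/QQ.
- by move=> h; split=> //; apply: HF h.
- by move/QQ.
Qed.

(** * The sweep over candidate times *)

Section Main.
Variables (V S n : nat) (L R : nat -> nat).
Let nn := n * n.
Let k := size (undets n L R).
Hypothesis V_n : n * n + n + 10 <= V.
Hypothesis V_k : 2 ^ k + 3 ^ k <= V.
Hypothesis V_t : forall p, p < nn -> L p + k <= V.
Hypothesis S_n : 4 * nn + 2 * 2 ^ k <= S.
Hypothesis diag1 : forall p, p < nn -> diag n p -> L p = 1 /\ R p = 1.

Definition next_cost := nn * (7 * k + 12) + 3.

Lemma wp_next t s : core n L R s -> rg s 9 = t ->
  wp V S next_prog (fun s' =>
    best t (fun x => x \in times n L R) (rg s' 10) /\ ck s' <= ck s + next_cost) s.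
Proof.
move=> cs h9; have [[_ h1 h2 _ _] hL _] := cs; rewrite -/nn -/k in h1 h2.
have nV : nn + n + 10 <= V := V_n.
have kV : k < V by have := ltn_expl k (isT : 1 < 2); move: V_k; clear; lia.
pose P i x := exists p j, [/\ p < i, j <= k & x = L p + j].
apply: wp_seq; asgl.
apply: (@wp_for V S _ _ _ nn (fun i s' =>
  best t (P i) (rg s' 10) /\ ck s' <= ck s + (i * (7 * k + 12) + 2))).
- by clear -nV; lia.
- by move=> i s' _ [f _] _; split=> //; ev; rewrite f.
- by split; ev; [left; split=> // x [p [j []]]|clear; lia].
- move=> i s' iN [f m] xi [b c].
  have mi : mm s' (2 * i) = L i by rewrite m //; evm; apply: (hL i iN).1.
  have Lk := V_t iN; rewrite -/k in Lk.
  apply: wp_seq; apply: wp_asg; ev; rewrite ?xi ?mi //.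
  + by move: S_n; clear -iN; split=> //; lia.
  + by clear -Lk; lia.
  set s2 := setr _ 7 _.
  apply: (@wp_for V S _ _ _ k.+1 (fun j s' =>
    best t (fun x => P i x \/ exists2 j', j' < j & x = L i + j') (rg s' 10) /\
    ck s' <= ck s2 + (7 * j + 1))).
  + by clear -kV; lia.
  + by move=> j s3 _ [f3 _] _; split=> //; ev; rewrite f3 // /s2; ev; rewrite f // addn1; ev; rewrite h2.
  + split; ev; last by clear; lia.
    by apply: eq_best b => x; split=> [|[//|[j' /=]]]; [left|rewrite ltn0].
  + move=> j s3 jk [f3 _] xj [b3 c3].
    have e7 : rg s3 7 = L i by rewrite f3.
    have e9 : rg s3 9 = t by rewrite f3 // /s2; ev; rewrite f.
    have e6 : rg s3 6 = i by rewrite f3.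
    have fin s4 : rg s4 10 = (if (t < L i + j) && ((rg s3 10 == 0) || (L i + j <= rg s3 10))
          then L i + j else rg s3 10) -> rg s4 25 = j -> ck s4 <= ck s3 + 6 ->
        rg s4 25 = j /\ (best t (fun x => P i x \/ exists2 j', j' < j.+1 & x = L i + j')
          (rg (setr s4 25 j.+1) 10) /\ ck (setr s4 25 j.+1) <= ck s2 + (7 * j.+1 + 1)).
      move=> E10 E25 E; split=> //; split; last by ev; clear -E c3; lia.
      ev; apply: eq_best (best_add b3 E10) => x; split.
        case=> [[?|[j' jj' ->]]|->]; [by left|right; exists j'; lia|right; by exists j].
      case=> [?|[j' jj' ->]]; first by left; left.
      case: (ltnP j' j) => h; [left; right; by exists j'|right].
      by congr (_ + _); clear -jj' h; lia.
    apply: wp_seq; apply: wp_asg; ev; rewrite ?e7 ?xj //; first by clear -Lk jk; lia.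
    apply: wp_if => //; ev; rewrite ?e9 => i1.
      have t1 : t < L i + j by clear -i1; lia.
      apply: wp_if => //; ev => i2.
        apply: wp_asg; [by []|by ev; clear -Lk jk; lia|].
        apply: fin; ev => //; last by clear; lia.
        by rewrite t1 (_ : rg s3 10 == 0) //; clear -i2; lia.
      apply: wp_if => //; ev => i3.
        apply: wp_asg; [by []|by ev; clear -Lk jk; lia|].
        apply: fin; ev => //; last by clear; lia.
        by rewrite t1 i3 orbT.
      asgl; apply: fin; ev => //; last by clear; lia.
      by rewrite ifF //; clear -i2 i3; lia.
    asgl; apply: fin; ev => //; last by clear; lia.
    by rewrite ifF //; clear -i1; lia.
  + move=> s3 [f3 _] _ [b3 c3]; ev; rewrite f3 //; split; first by rewrite /s2; ev.
    split; last by move: c3; rewrite /s2; ev; clear -c; lia.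
    apply: eq_best b3 => x; split.
      case=> [[p [j [pi jk ->]]]|[j jk ->]]; first by exists p, j; split=> //; clear -pi; lia.
      by exists i, j; split=> //; clear -jk; lia.
    case=> p [j [pi jk ->]]; case: (ltnP p i) => h; first by left; exists p, j.
    by right; exists j => //; congr (L _ + _); clear -pi h; lia.
- move=> s' _ _ [b c]; ev; split; last by rewrite /next_cost; clear -c; lia.
  by apply: eq_best b => x; split=> [?|/timesP //]; apply/timesP.
Qed.

(** The agenda of times still to come. It provides the fuel of the main loop and the index set of
    its cost, but the program never stores it. *)
Definition rest (t : nat) (ts : seq nat) : Prop :=
  sorted ltn ts /\ forall x, (x \in ts) = (x \in times n L R) && (t < x).

Lemma rest_best t ts b : rest t ts -> best t (fun x => x \in times n L R) b ->
  if ts is t' :: ts' then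
    [/\ b = t', t' \in times n L R, t < t',
        (forall x, x \in times n L R -> t < x -> t' <= x) & rest t' ts']
  else b = 0 /\ forall x, x \in times n L R -> x <= t.
Proof.
case: ts => [|t' ts'] [so mem] Hb.
  have no x : x \in times n L R -> x <= t.
    by move=> xT; rewrite leqNgt; apply/negP => tx; have := mem x; rewrite xT tx.
  by split=> //; case: Hb => [[]|[/no h1 h2 _]] //; move: h1 h2; lia.
have /andP[t'T tt'] : (t' \in times n L R) && (t < t') by rewrite -mem mem_head.
have ts'lt x : x \in ts' -> t' < x.
  by move: so => /= /(order_path_min ltn_trans) /allP; apply.
have mint x : x \in times n L R -> t < x -> t' <= x.
  move=> xT tx; have : x \in t' :: ts' by rewrite mem xT tx.
  by rewrite inE => /orP[/eqP -> //|/ts'lt]; lia.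
split=> //.
  case: Hb => [[_ H]|[H1 H2 H3]]; first by have := H t' t'T; lia.
  by have := H3 t' t'T tt'; have := mint b H1 H2; lia.
split; first by move: so => /= /path_sorted.
move=> x; apply/idP/idP => [xt|/andP[xT t'x]].
  by rewrite ts'lt // andbT; have := mem x; rewrite inE xt orbT => /esym/andP[].
have := mem x; rewrite xT (ltn_trans tt' t'x) inE => /orP[/eqP e|//].
by rewrite e ltnn in t'x.
Qed.

Definition main_cost (ts : seq nat) :=
  \sum_(t <- ts) (round_cost n L R t + next_cost + 2) + 1.

Lemma wloop_main ts t s : rest t ts -> 0 < t -> core n L R s -> table n L R s t ->
  best t (fun x => x \in times n L R) (rg s 10) ->
  wloop S #0 $10 (wp V S (Asg 9 $10 ;; round_prog ;; next_prog))
    (fun s' => core n L R s' /\ ck s' <= ck s + main_cost ts /\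
       exists2 t', forall x, x \in times n L R -> x <= t' & table n L R s' t')
    (size ts) s.
Proof.
elim: ts t s => [|t' ts IH] t s Hr t0 cs tab Hb.
  have [b0 no] := rest_best Hr Hb.
  split; [by []|by []|]; ev; rewrite b0 ltnn; split=> //; split; last by exists t.
  by rewrite /main_cost big_nil; clear; lia.
have [bt t'T tt' gap Hr'] := rest_best Hr Hb.
split; [by []|by []|]; ev; rewrite bt (leq_ltn_trans (leq0n t) tt').
apply: wp_seq; apply: wp_asg; ev => //.
  rewrite bt; case/timesP: t'T => p [j [pn jk ->]]; have := V_t pn.
  by move: jk; rewrite -/k; clear; lia.
set s1 := setr _ 9 _.
have cs1 : core n L R s1 by apply: core_frame cs => [[|[|[|[|[|]]]]]|].
have tab1 : table n L R s1 t by [].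
have e9 : rg s1 9 = t' by rewrite /s1; ev.
apply: wp_seq.
apply: wp_use (wp_round V_n V_k S_n diag1 cs1 e9 tab1 t0 tt' t'T gap) _.
move=> s2 [f2 _] [cs2 tab2 c2].
have e9' : rg s2 9 = t' by rewrite f2.
apply: wp_use (wp_next cs2 e9') _ => s3 [f3 m3] [b3 c3].
have mE : mm s3 = mm s2 by apply: m3.
have cs3 : core n L R s3.
  by apply: core_frame cs2 => [[|[|[|[|[|]]]]] // _|a _]; rewrite ?f3 // mE.
have tab3 : table n L R s3 t' by move=> g; rewrite mE.
have := IH t' s3 Hr' (leq_ltn_trans (leq0n t) tt') cs3 tab3 b3.
have impl s' : core n L R s' /\ ck s' <= ck s3 + main_cost ts /\
    (exists2 t', forall x, x \in times n L R -> x <= t' & table n L R s' t') ->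
    core n L R s' /\ ck s' <= ck s + main_cost (t' :: ts) /\
    (exists2 t', forall x, x \in times n L R -> x <= t' & table n L R s' t').
  case=> h1 [h2 h3]; split=> //; split=> //.
  by move: c2 c3 h2; rewrite /s1 /main_cost big_cons; ev; clear; lia.
apply: wloop_mono => //.
by move=> P P' s'; apply: wp_mono.
Qed.

Definition later_times : seq nat :=
  sort leq (undup [seq x <- times n L R | 1 < x]).

Lemma rest_later : rest 1 later_times.
Proof.
split; last by move=> x; rewrite mem_sort mem_undup mem_filter andbC.
by rewrite ltn_sorted_uniq_leq sort_uniq undup_uniq sort_sorted //; apply: leq_total.
Qed.

Lemma wp_main s : core n L R s -> rg s 9 = 1 -> table n L R s 1 ->
  wp V S main_prog (fun s' => core n L R s' /\
    ck s' <= ck s + (next_cost + main_cost later_times) /\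
    exists2 t', forall x, x \in times n L R -> x <= t' & table n L R s' t') s.
Proof.
move=> cs h9 tab.
apply: wp_seq; apply: wp_use (wp_next cs h9) _ => s3 [f3 m3] [b3 c3].
have mE : mm s3 = mm s by apply: m3.
have cs3 : core n L R s3.
  by apply: core_frame cs => [[|[|[|[|[|]]]]] // _|a _]; rewrite ?f3 // mE.
have tab3 : table n L R s3 1 by move=> g; rewrite mE.
apply: (@wp_mono _ _ _ (fun s' => core n L R s' /\ ck s' <= ck s3 + main_cost later_times /\
    exists2 t', forall x, x \in times n L R -> x <= t' & table n L R s' t')).
  by move=> s' [h1 [h2 h3]]; split=> //; split=> //; clear -h2 c3; lia.
by exists (size later_times); apply: wloop_main rest_later _ _ _ _.
Qed.

Lemma size_later : size later_times <= nn * k.+1.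
Proof.
rewrite size_sort; apply: leq_trans (size_undup _) _.
rewrite size_filter; apply: leq_trans (count_size _ _) _.
by rewrite size_allpairs !size_iota.
Qed.

(** Exchange the sums: entry [p] is counted only at time [L p], which occurs at most once in
    [ts]. *)
Lemma sum_det_count ts : uniq ts -> \sum_(t <- ts) det_count n L R t <= nn.
Proof.
move=> us; have -> : nn = size (iota 0 nn) by rewrite size_iota.
rewrite /det_count -/nn; elim: (iota 0 nn) => [|p l IH] /=; first by rewrite big1.
rewrite big_split /= -add1n leq_add //.
apply: (@leq_trans (count_mem (L p) ts)); last by rewrite count_uniq_mem // leq_b1.
rewrite -sum1_count [X in _ <= X]big_mkcond /=.
by apply: leq_sum => t _; rewrite eq_sym; case: eqP => //= _; rewrite ?andbF // leq_b1.
Qed.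

End Main.

(** * Preprocessing of the input *)

Definition classify_prog : cmd :=
  Asg 7 (ELd (#2 :*: $6)) ;;
  Asg 8 (ELd (#2 :*: $6 :+: #1)) ;;
  Asg 24 ($6 :/: $0) ;;
  Asg 23 ($6 :-: $24 :*: $0) ;;
  If (($23 :-: $24) :+: ($24 :-: $23)) #0
    (If (($7 :-: #1) :+: (#1 :-: $8)) #0 skip (Asg 5 #0) ;; Asg 7 #1 ;; Asg 8 #1)
    (Asg 7 ($7 :+: (#2 :-: $7)) ;; If $7 $8 skip (Asg 5 #0 ;; Asg 8 $7)).

Definition record_prog : cmd :=
  Sto (#2 :*: $6) $7 ;;
  Sto (#2 :*: $6 :+: #1) $8 ;;
  If (($7 :-: $8) :+: ($8 :-: $7)) #0 skip
    (Sto (#2 :*: $1 :+: $2) $6 ;;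
     Asg 2 ($2 :+: #1) ;; Asg 3 ($3 :*: #2) ;; Asg 4 ($4 :*: #3)).

Definition pre_prog : cmd :=
  Asg 1 ($0 :*: $0) ;; Asg 2 #0 ;; Asg 3 #1 ;; Asg 4 #1 ;; Asg 5 #1 ;;
  For 6 $1 (classify_prog ;; record_prog) ;;
  For 29 $3 (Sto (#4 :*: $1 :+: $29) #0) ;;
  Sto (#4 :*: $1) #1 ;;
  Asg 9 #1.

(** Address [2 ^ k - 1] of the table belongs to the mask in which every entry is reached; register 5
    tells whether all ranges were consistent. *)
Definition tgr_prog : cmd :=
  pre_prog ;; main_prog ;; Asg 0 ($5 :*: ELd (#4 :*: $1 :+: ($3 :-: #1))).

Lemma cod2_true k : (cod 2 (fun=> true) k).+1 = 2 ^ k.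
Proof.
by elim: k => [|k IH]; rewrite ?codS ?expnS /cod ?big_ord0 //; rewrite /cod in IH; lia.
Qed.

Lemma cod2_eq0 (f : nat -> bool) k :
  cod 2 f k = 0 <-> forall i, i < k -> f i = false.
Proof.
have c0 : cod 2 (fun=> 0) k = 0 by rewrite /cod big1.
split=> [e i ik|H]; last by rewrite (@eq_cod 2 _ (fun=> 0)) // => i /H ->.
have {}e := etrans e (esym c0).
have h : (f i : nat) = 0.
  by apply: (@cod_inj 2 (fun i => f i) (fun=> 0) k _ _ e i ik) => j _ //;
    rewrite ltnS leq_b1.
by move: h; case: (f i).
Qed.

Section Preprocess.
Variables (V S n : nat) (m0 : nat -> nat).
Let nn := n * n.
Let L := lo n m0.
Let R := hi n m0.
Let k := size (undets n L R).
Hypothesis V_n : n * n + n + 10 <= V.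
Hypothesis V_k : 2 ^ k + 3 ^ k <= V.
Hypothesis V_m : forall a, m0 a + 2 <= V.
Hypothesis S_n : 4 * nn + 2 * 2 ^ k <= S.

Lemma lo_le p : L p <= V.
Proof.
rewrite /L /lo; have := V_m (2 * p); case: (diag n p) => h; first by clear -h; lia.
by rewrite geq_max; apply/andP; clear -h; lia.
Qed.

Lemma hi_le p : R p <= V.
Proof.
rewrite /R /hi; have h1 := V_m (2 * p).+1; have h2 := lo_le p.
case: (diag n p); first by clear -h1; lia.
by rewrite geq_max; apply/andP; split; [clear -h1; lia|].
Qed.

Lemma lo_hi p : p < nn -> L p <= R p.
Proof. by move=> _; rewrite /R /hi /L /lo; case: (diag n p); rewrite ?leq_maxr. Qed.

Lemma lo_diag p : p < nn -> diag n p -> L p = 1 /\ R p = 1.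
Proof. by move=> _ d; rewrite /R /hi /L /lo d. Qed.

Lemma lo_offdiag p : p < nn -> ~~ diag n p -> 1 < L p.
Proof. by move=> _ /negPf d; rewrite /L /lo d leq_maxr. Qed.

Lemma wp_classify p (b : bool) s : p < nn -> rg s 0 = n -> rg s 6 = p ->
  rg s 5 = b -> mm s (2 * p) = m0 (2 * p) -> mm s (2 * p + 1) = m0 (2 * p).+1 ->
  wp V S classify_prog (fun s' => [/\ rg s' 7 = L p, rg s' 8 = R p,
    rg s' 5 = b && consistent n m0 p & ck s' <= ck s + 9]) s.
Proof.
move=> pn h0 h6 h5 e1 e2; have nV : nn + n + 10 <= V := V_n.
have [m1 v1] : m0 (2 * p) + 2 <= V /\ m0 (2 * p).+1 + 2 <= V by [].
have /andP[pd pm] := entry_div pn.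
have modE : p - p %/ n * n = p %% n by rewrite {1}(divn_eq p n) addKn.
have Sp : 2 * p + 1 < S by move: S_n; clear -pn; lia.
have [Lp Rp] : L p <= V /\ R p <= V by split; [exact: lo_le|exact: hi_le].
apply: wp_seq; apply: wp_asg; ev; rewrite ?h6 ?e1 //; [by clear -Sp; split=> //; lia|by clear -m1; lia|].
apply: wp_seq; apply: wp_asg; ev; rewrite ?h6 ?e2 //; [by clear -v1; lia|].
apply: wp_seq; apply: wp_asg; ev; rewrite ?h6 ?h0 //; [by clear -pd nV; lia|].
apply: wp_seq; apply: wp_asg; ev; rewrite ?h6 ?h0 ?modE //; [by clear -pm nV; lia|].
have dE : diag n p = (p %% n - p %/ n + (p %/ n - p %% n) <= 0).
  by rewrite /diag; clear; lia.
apply: wp_if => //; ev; [rewrite -dE => d|rewrite ltnNge -dE => /negPf d].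
  have LE : L p = 1 by rewrite /L /lo d.
  have RE : R p = 1 by rewrite /R /hi d.
  have cE : consistent n m0 p = (m0 (2 * p) - 1 + (1 - m0 (2 * p).+1) <= 0).
    by rewrite /consistent d; clear; lia.
  rewrite cE LE RE; apply: wp_seq; apply: wp_if => //; ev => h.
    asgl; apply: wp_seq; asgl; asgl; ev; rewrite h h5 andbT; split=> //.
    by clear; lia.
  asgl; apply: wp_seq; asgl; asgl; ev; rewrite leqNgt h andbF; split=> //.
  by clear; lia.
have LE : L p = m0 (2 * p) + (2 - m0 (2 * p)).
  by rewrite /L /lo d; clear; lia.
apply: wp_seq; apply: wp_asg; ev; rewrite -?LE //.
have cE : consistent n m0 p = (L p <= m0 (2 * p).+1) by rewrite /consistent d.
have RE : R p = maxn (m0 (2 * p).+1) (L p) by rewrite /R /hi d.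
rewrite cE; apply: wp_if => //; ev => h.
  asgl; ev; rewrite h h5 andbT RE (maxn_idPl h); split=> //; clear; lia.
apply: wp_seq; asgl; apply: wp_asg; ev => //.
rewrite leqNgt h andbF RE (maxn_idPr (ltnW h)); split=> //; clear; lia.
Qed.

Lemma size_undets_prefix i : i <= nn ->
  size [seq p <- iota 0 i | undet L R p] <= k.
Proof.
move=> iN; rewrite /k /undets -/nn -[in X in _ <= X](subnKC iN) iotaD filter_cat.
by rewrite size_cat leq_addr.
Qed.

Lemma wp_pre s : rg s 0 = n -> mm s =1 m0 ->
  wp V S pre_prog (fun s' => [/\ core n L R s', table n L R s' 1,
    rg s' 9 = 1, rg s' 5 = all (consistent n m0) (iota 0 nn)
    & ck s' <= ck s + (20 * nn + 3 * 2 ^ k + 13)]) s.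
Proof.
move=> h0 hm; have nV : nn + n + 10 <= V := V_n.
apply: wp_seq; apply: wp_asg; ev; rewrite ?h0 //; first by clear -nV; move: nV; rewrite /nn; lia.
do 4 (apply: wp_seq; asgl).
set s1 := setr _ 5 _.
pose Ei i := [seq p <- iota 0 i | undet L R p].
have EiS i : Ei i.+1 = if undet L R i then rcons (Ei i) i else Ei i.
  by rewrite /Ei -addn1 iotaD filter_cat /= add0n; case: ifP; rewrite ?cats1 ?cats0.
have kn : k <= nn by apply: k_le.
apply: wp_seq; apply: (@wp_use _ _ _ (fun s' =>
  [/\ [/\ rg s' 2 = k, rg s' 3 = 2 ^ k & rg s' 4 = 3 ^ k],
      forall p, p < nn -> mm s' (2 * p) = L p /\ mm s' (2 * p + 1) = R p,
      forall j, j < k -> mm s' (2 * nn + j) = nth 0 (undets n L R) j,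
      rg s' 5 = all (consistent n m0) (iota 0 nn)
    & ck s' <= ck s1 + (20 * nn + 2)])).
  (* Bounds are normalized in place, so the invariant separates the rewritten entries below [i] from
     the unread input; the list of undetermined entries starts behind both. *)
  apply: (@wp_for V S _ _ _ nn (fun i s' =>
    [/\ [/\ rg s' 2 = size (Ei i), rg s' 3 = 2 ^ size (Ei i) & rg s' 4 = 3 ^ size (Ei i)],
        forall p, p < i -> mm s' (2 * p) = L p /\ mm s' (2 * p + 1) = R p,
        (forall j, j < size (Ei i) -> mm s' (2 * nn + j) = nth 0 (Ei i) j) /\
        (forall a, 2 * i <= a < 2 * nn -> mm s' a = m0 a),
        rg s' 5 = all (consistent n m0) (iota 0 i)
      & ck s' <= ck s1 + (20 * i + 1)])).
  - by clear -nV; lia.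
  - by move=> i s' _ [f _] _; split=> //; ev; rewrite f // /s1; ev; rewrite h0.
  - by split=> //; ev; [split=> // a _; apply: hm|clear; lia].
  - move=> i s' iN [f _] xi [[e2 e3 e4] hL [hE hin] e5 c].
    have e0 : rg s' 0 = n by rewrite f.
    have e1 : rg s' 1 = nn by rewrite f // /s1; ev; rewrite h0.
    have ei1 : mm s' (2 * i) = m0 (2 * i) by apply: hin; clear -iN; lia.
    have ei2 : mm s' (2 * i + 1) = m0 (2 * i).+1 by rewrite addn1; apply: hin; clear -iN; lia.
    apply: wp_seq; apply: wp_use (@wp_classify i _ (tick s') iN e0 xi e5 ei1 ei2) _.
    move=> s2 [f2 m2] [g7 g8 g5 c2]; ev in c2.
    have {m2} mE : mm s2 = mm s' by rewrite m2.
    have a1 : rg s2 1 = nn by rewrite f2.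
    have a2 : rg s2 2 = size (Ei i) by rewrite f2.
    have a3 : rg s2 3 = 2 ^ size (Ei i) by rewrite f2.
    have a4 : rg s2 4 = 3 ^ size (Ei i) by rewrite f2.
    have a6 : rg s2 6 = i by rewrite f2.
    have [Lp Rp] : L i <= V /\ R i <= V by split; [exact: lo_le|exact: hi_le].
    have szi : size (Ei i) <= i.
      by rewrite size_filter; apply: leq_trans (count_size _ _) _; rewrite size_iota.
    have s4 : 4 * nn <= S by apply: leq_trans S_n; apply: leq_addr.
    apply: wp_seq; apply: wp_sto; ev; rewrite ?a6 ?g7 //; first by clear -iN s4; lia.
    apply: wp_seq; apply: wp_sto; ev; rewrite ?a6 ?g8 //; first by clear -iN s4; lia.
    have uE : undet L R i = ~~ (L i - R i + (R i - L i) <= 0).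
      by rewrite /undet; clear; lia.
    pose mb := updn (updn (mm s2) (2 * i) (L i)) (2 * i + 1) (R i).
    have mbL p : p < i.+1 -> mb (2 * p) = L p /\ mb (2 * p + 1) = R p.
      rewrite ltnS leq_eqVlt /mb !updnE eqn_add2r !eqn_mul2l /=.
      have -> : (2 * p == 2 * i + 1) = false by clear; lia.
      have -> : (2 * p + 1 == 2 * i) = false by clear; lia.
      by case: eqP => [-> //|_ /= pi]; rewrite mE; apply: hL.
    have mbo a : 2 * i.+1 <= a -> mb a = mm s' a.
      by move=> ha; rewrite /mb !updnE mE !ifF //; clear -ha; lia.
    apply: wp_if => //; ev; rewrite ?g7 ?g8 => h.
      have u0 : undet L R i = false by rewrite uE h.
      asgl; ev; rewrite a6 EiS u0 a2 a3 a4 g5 iotaS_all; split=> //; split=> //.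
        split=> [j jk|a /andP[ha ha']]; rewrite -/mb mbo // ?hE // ?hin //.
        - by clear -jk iN; lia.
        - by clear -ha ha'; lia.
      by clear -c c2; lia.
    have u1 : undet L R i by rewrite uE -ltnNge.
    have szk : (size (Ei i)).+1 <= k.
      have := size_undets_prefix iN; rewrite -/(Ei i.+1) EiS u1 size_rcons.
      by [].
    have p2 : 2 ^ (size (Ei i)).+1 <= 2 ^ k by rewrite leq_pexp2l.
    have p3 : 3 ^ (size (Ei i)).+1 <= 3 ^ k by rewrite leq_pexp2l.
    apply: wp_seq; apply: wp_sto; ev; rewrite ?a1 ?a2 ?a6 //.
    + by clear -szi iN s4; lia.
    + by clear -iN nV; lia.
    apply: wp_seq; apply: wp_asg; ev; rewrite ?a2 //; first by clear -szk kn nV; lia.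
    apply: wp_seq; apply: wp_asg; ev; rewrite ?a3 -?expnSr //; first by clear -p2 V_k; lia.
    apply: wp_asg; ev; rewrite ?a4 -?expnSr //; first by clear -p3 V_k; lia.
    rewrite a6 EiS u1 size_rcons g5 iotaS_all addn1; split=> //; split=> //.
    + move=> p pi; rewrite -/mb; have := mbL p pi; rewrite !(updnE mb) !ifF //.
        by clear -pi iN; lia.
      by clear -pi iN; lia.
    + split=> [j|a /andP[ha ha']]; rewrite -/mb updnE.
        rewrite ltnS eqn_add2l nth_rcons => jk; case: eqP => [->|ne]; first by rewrite ltnn.
        have jl : j < size (Ei i) by clear -jk ne; lia.
        by rewrite jl mbo ?hE //; clear -iN; lia.
      rewrite ifF ?mbo ?hin //; first by clear -ha ha'; lia.
      by clear -ha'; lia.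
    + by clear -c c2; lia.
  - move=> s' _ _ [h1 h2 [h3 _] h4 h5]; ev; split=> //.
    by clear -h5; lia.
move=> s2 [f2 _] [[e2 e3 e4] hL hE e5 c2].
have e0 : rg s2 0 = n by rewrite f2.
have e1 : rg s2 1 = nn by rewrite f2 // /s1; ev; rewrite h0.
have cs2 : core n L R s2 by [].
have [pk pkE] : exists pk, 2 ^ k = pk by eexists.
have Vpk : pk + 3 ^ k <= V by rewrite -pkE.
have Spk : 4 * nn + 2 * pk <= S by rewrite -pkE.
have pk0 : 0 < pk by rewrite -pkE expn_gt0.
apply: wp_seq; apply: (@wp_use _ _ _ (fun s' =>
  [/\ forall m, m < pk -> mm s' (4 * nn + m) = 0,
      forall a, a < 4 * nn -> mm s' a = mm s2 a & ck s' <= ck s2 + (3 * pk + 2)])).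
  apply: (@wp_for V S _ _ _ pk (fun i s' =>
    [/\ forall m, m < i -> mm s' (4 * nn + m) = 0,
      forall a, a < 4 * nn -> mm s' a = mm s2 a & ck s' <= ck s2 + (3 * i + 1)])).
  - by clear -Vpk; lia.
  - by move=> i s' _ [f _] _; split=> //; ev; rewrite f // e3.
  - by split=> //; ev; clear; lia.
  - move=> i s' ip [f _] xi [g o c].
    have a1 : rg s' 1 = nn by rewrite f.
    apply: wp_sto; ev; rewrite ?a1 ?xi //; first by clear -ip Spk; lia.
    split=> //; split; evm.
    + move=> m; rewrite ltnS updnE eqn_add2l => mi; case: eqP => // ne.
      by apply: g; clear -mi ne; lia.
    + by move=> a ha; rewrite updnE ifF ?o //; clear -ha; lia.
    + by clear -c; lia.
  - by move=> s' _ _ [g o c]; ev; split=> //; clear -c; lia.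
move=> s3 [f3 _] [g3 o3 c3].
have a1 : rg s3 1 = nn by rewrite f3.
apply: wp_seq; apply: wp_sto; ev; rewrite ?a1 //; [by clear -Spk pk0; lia|by clear -nV; lia|].
asgl; split=> //.
- apply: core_frame cs2 => [x x4|a ha].
    by case: x x4 => [|[|[|[|[|]]]]] // _; ev; rewrite f3.
  rewrite -/nn in ha; have ha' : a < 4 * nn by clear -ha; lia.
  by evm; rewrite updnE ifF ?o3 //; clear -ha'; lia.
- move=> f; evm; rewrite updnE -/nn -/k.
  have fb : cod 2 f k < pk by rewrite -pkE; apply: cod_lt => i _; rewrite ltnS leq_b1.
  have -> : (4 * nn + cod 2 f k == 4 * nn) = (cod 2 f k == 0) by clear; lia.
  rewrite g3 //; case: eqP => [/cod2_eq0 H|H]; case: asboolP => //.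
    by case; apply/(reachable_init lo_hi lo_diag lo_offdiag).
  by move/(reachable_init lo_hi lo_diag lo_offdiag)/cod2_eq0.
- by ev; rewrite f3.
- by evm; move: c2 c3; rewrite /s1; ev; rewrite pkE; clear; lia.
Qed.

Hypothesis V_t : forall p, p < nn -> L p + k <= V.

Definition total_cost :=
  20 * nn + 3 * 2 ^ k + 14 +
  (next_cost n L R + main_cost n L R (later_times n L R)).

Lemma wp_tgr s : rg s 0 = n -> mm s =1 m0 ->
  wp V S tgr_prog (fun s' =>
    rg s' 0 = all (consistent n m0) (iota 0 nn) &&
              `[< exists A, realizes n L R A >] /\
    ck s' <= ck s + total_cost) s.
Proof.
move=> h0 hm; have nV : nn + n + 10 <= V := V_n.
apply: wp_seq; apply: wp_use (wp_pre h0 hm) _ => s1 _ [cs1 tab1 e9 e5 c1].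
apply: wp_seq; apply: wp_use (wp_main V_n V_k V_t S_n lo_diag cs1 e9 tab1) _.
move=> s2 [f2 _] [cs2 [c2 [t Ht tab2]]].
have [[_ a1 _ a3 _] _ _] := cs2; rewrite -/nn -/k in a1 a3.
have a5 : rg s2 5 = rg s1 5 by rewrite f2.
have Sk := S_n.
have pk0 : 0 < 2 ^ k by rewrite expn_gt0.
have mE : mm s2 (4 * nn + (2 ^ k - 1)) = `[< exists A, realizes n L R A >].
  rewrite -cod2_true subn1 tab2; congr nat_of_bool.
  by apply/asbool_equiv_eq/(reachable_final lo_diag lo_offdiag).
apply: wp_asg; ev; rewrite ?a1 ?a3 ?a5 ?mE ?e5 ?mulnb //.
- by split=> //; split=> //; clear -Sk pk0; lia.
- by apply: leq_trans (leq_b1 _) _; clear -nV; lia.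
- by split=> //; rewrite /total_cost; clear -c1 c2; lia.
Qed.

End Preprocess.

(** * Cost and correctness *)

Lemma sum_affine (d : nat -> nat) a b ts :
  \sum_(t <- ts) (a + b * d t) = size ts * a + b * \sum_(t <- ts) d t.
Proof.
elim: ts => [|t ts IH]; rewrite ?big_nil ?big_cons ?IH //=; first by lia.
by rewrite mulnDr mulSn; lia.
Qed.

(** 263 is 184 + 19 + 60: the rounds without the supports of determined entries, these supports, and
    everything outside the rounds. The maxima with 1 absorb lower-order terms. *)
Lemma total_cost_le n m0 k0 : size (undets n (lo n m0) (hi n m0)) <= k0 ->
  total_cost n m0 <= 263 * (maxn k0 1 ^ 2 * 3 ^ k0 * maxn n 1 ^ 4).
Proof.
move=> kk0; rewrite /total_cost; set L := lo n m0; set R := hi n m0.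
set ts := later_times n L R.
have sts := size_later n L R; have usts : uniq ts by rewrite sort_uniq undup_uniq.
have dts := sum_det_count n L R usts.
move: sts dts; rewrite -/ts.
rewrite /main_cost /round_cost /step_cost /next_cost.
move: kk0; rewrite -/L -/R; move: (size (undets n L R)) => k kk0 sts dts.
have [N NE] : exists N, maxn n 1 = N by eexists.
have [K KE] : exists K, maxn k0 1 = K by eexists.
have [T TE] : exists T, 3 ^ k0 = T by eexists.
have k3 : 3 ^ k <= T by rewrite -TE leq_pexp2l.
have k3' : 0 < 3 ^ k by rewrite expn_gt0.
have k2 : 2 ^ k <= 3 ^ k by clear; elim: k => // k IH; rewrite !expnS leq_mul.
have nN : n <= N by rewrite -NE leq_maxl.
have N1 : 0 < N by rewrite -NE leq_maxr.
have kK : k <= K by rewrite -KE; apply: leq_trans kk0 (leq_maxl _ _).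
have K1 : 0 < K by rewrite -KE leq_maxr.
rewrite NE KE TE.
have [M ME] : exists M, N * N = M by eexists.
have nM : n * n <= M by rewrite -ME; apply: leq_mul.
have M1 : 0 < M by rewrite -ME muln_gt0 N1.
(* 19 is 6 + 8 + 5. *)
have nnM : n * (6 * n + 8) + 5 <= 19 * M by rewrite -ME; clear -nN N1; nia.
have MK : M <= M * K by rewrite leq_pmulr.
have KM : K <= M * K by rewrite leq_pmull.
have T1 : 0 < T by apply: leq_trans k3' k3.
(* The cost of a round is split into a uniform part and one proportional to the determined entries
   new in it, to be summed separately. 92 is 68 + 19 + 5: the codes, the search for the next time,
   and constants. *)
have each t : 3 ^ k * (10 * (n * n) + 12 * k + (det_count n L R t + k) * (n * (6 * n + 8) + 5) + 13 + 2)
    + 6 * 2 ^ k + 6 + (n * n * (7 * k + 12) + 3) + 2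
    <= T * (92 * (M * K)) + T * (19 * M) * det_count n L R t.
  move: (det_count n L R t) => d.
  have h1 : (d + k) * (n * (6 * n + 8) + 5) <= d * (19 * M) + 19 * (M * K).
    apply: leq_trans (leq_mul (leqnn _) nnM) _.
    by rewrite mulnDl leq_add2l mulnCA leq_mul2l mulnC leq_mul2l kK orbT.
  (* The additional 12, multiplied by [3 ^ k], pays for [6 * 2 ^ k + 6]. *)
  have h2 : 10 * (n * n) + 12 * k + (d + k) * (n * (6 * n + 8) + 5) + 13 + 2 + 12
      <= 68 * (M * K) + d * (19 * M) by clear -h1 nM kK MK KM M1; lia.
  have h3 := leq_mul k3 h2.
  have h4 : n * n * (7 * k + 12) <= 19 * (M * K).
    apply: leq_trans (leq_mul nM (_ : _ <= 19 * K)) _; first by clear -kK K1; lia.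
    by rewrite mulnCA.
  have h5 : M * K <= T * (M * K) by rewrite leq_pmull.
  by clear -h3 h4 h5 k2 k3' MK M1; lia.
have sum1 : \sum_(t <- ts) (3 ^ k * (10 * (n * n) + 12 * k + (det_count n L R t + k) * (n * (6 * n + 8) + 5) + 13 + 2)
    + 6 * 2 ^ k + 6 + (n * n * (7 * k + 12) + 3) + 2) <=
    \sum_(t <- ts) (T * (92 * (M * K)) + T * (19 * M) * det_count n L R t).
  by apply: leq_sum => t _; apply: each.
rewrite sum_affine in sum1.
have h6 : size ts * (T * (92 * (M * K))) <= 184 * (K ^ 2 * T * N ^ 4).
  (* [k.+1 <= 2 * K], whence 184 is twice 92. *)
  have h : size ts <= M * (2 * K).
    by apply: leq_trans sts (leq_mul nM _); clear -kK K1; lia.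
  apply: leq_trans (leq_mul h (leqnn _)) _.
  by rewrite -ME !expnS !expn0; clear; lia.
have h7 : T * (19 * M) * \sum_(t <- ts) det_count n L R t <= 19 * (K ^ 2 * T * N ^ 4).
  apply: leq_trans (leq_mul (leqnn _) (leq_trans dts nM)) _.
  have -> : T * (19 * M) * M = 19 * (T * N ^ 4) by rewrite -ME !expnS !expn0; clear; lia.
  by rewrite leq_mul2l /= -mulnA leq_pmull // expn_gt0 K1.
have h8 : T * (M * K) <= K ^ 2 * T * N ^ 4.
  have -> : K ^ 2 * T * N ^ 4 = T * (M * K) * (M * K).
    by rewrite -ME !expnS !expn0; clear; lia.
  by rewrite leq_pmulr // muln_gt0 M1.
have h4 : n * n * (7 * k + 12) <= 19 * (M * K).
  apply: leq_trans (leq_mul nM (_ : _ <= 19 * K)) _; first by clear -kK K1; lia.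
  by rewrite mulnCA.
have h5 : M * K <= T * (M * K) by rewrite leq_pmull.
have h9 : T <= T * (M * K) by rewrite leq_pmulr // muln_gt0 M1.
move: (K ^ 2 * T * N ^ 4) (T * (M * K)) h5 h6 h7 h8 h9 sum1 => Z Y h5 h6 h7 h8 h9 sum1.
by clear -h4 h5 h6 h7 h8 h9 sum1 nM MK M1 k2 k3; lia.
Qed.

(** * Input layout and final assembly *)

Lemma nth_flatten_const (T : Type) (x0 : T) c (ss : seq (seq T)) p r :
  all (fun s => size s == c) ss -> p < size ss -> r < c ->
  nth x0 (flatten ss) (p * c + r) = nth x0 (nth [::] ss p) r.
Proof.
move=> + + rc; elim: ss p => [|s ss IH] p //= /andP[/eqP sc alls].
case: p => [|p] /= pn; rewrite nth_cat sc; first by rewrite rc.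
by rewrite mulSn -addnA ltnNge leq_addr /= addKn IH.
Qed.

Lemma input_words_nth n (D : 'M[int * int]_n) (u v : 'I_n) :
  nth 0%R (input_words D) (2 * (u * n + v)) = (D u v).1 /\
  nth 0%R (input_words D) (2 * (u * n + v)).+1 = (D u v).2.
Proof.
pose f (u : 'I_n) (v : 'I_n) := [:: (D u v).1; (D u v).2].
have szr : all (fun s : seq (seq int) => size s == n) [seq [seq f u v | v <- enum 'I_n] | u <- enum 'I_n].
  by apply/allP => _ /mapP[x _ ->]; rewrite size_map size_enum_ord.
have alls : all (fun s : seq int => size s == 2) [seq f u v | u <- enum 'I_n, v <- enum 'I_n].
  by apply/allP => _ /allpairsP[[x y] [_ _ ->]].
have szl : size [seq f u v | u <- enum 'I_n, v <- enum 'I_n] = n * n.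
  by rewrite size_allpairs size_enum_ord.
have E : nth [::] [seq f u v | u <- enum 'I_n, v <- enum 'I_n] (u * n + v) = f u v.
  have un : u < size [seq [seq f u v | v <- enum 'I_n] | u <- enum 'I_n].
    by rewrite size_map size_enum_ord.
  rewrite (nth_flatten_const _ szr un (ltn_ord v)).
  rewrite (nth_map u) ?size_enum_ord // (nth_map u) ?size_enum_ord //.
  by rewrite !nth_ord_enum.
have pn : u * n + v < size [seq f u v | u <- enum 'I_n, v <- enum 'I_n].
  by rewrite szl; apply: entry_lt.
rewrite /input_words -/f; split.
  by rewrite mulnC -[_ * 2]addn0 (nth_flatten_const _ alls) // E.
by rewrite mulnC -addn1 (nth_flatten_const _ alls) // E.
Qed.

Lemma input_words_le n (D : 'M[int * int]_n) i :
  `|nth 0%R (input_words D) i|%N <= magnitude D.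
Proof.
case: (ltnP i (size (input_words D))) => h; last by rewrite nth_default.
have /flattenP[s /allpairsP[[u v] [_ _ ->]] /=] := mem_nth 0%R h.
have hm : maxn `|(D u v).1|%N `|(D u v).2|%N <= magnitude D.
  apply: leq_trans (leq_bigmax u); exact: (leq_bigmax (F := fun v => maxn `|(D u v).1|%N `|(D u v).2|%N) v).
by rewrite !inE => /orP[]/eqP ->; apply: leq_trans hm; rewrite ?leq_maxl ?leq_maxr.
Qed.

(** Equal endpoints are clamped to equal bounds and the diagonal becomes fixed, so clamping creates
    no undetermined entry; the [k] of the program may be smaller than that of the input. *)
Lemma undets_le n (D : 'M[int * int]_n) (m : nat -> nat) :
  (forall u v : 'I_n, m (2 * (u * n + v)) = view (D u v).1 /\
                      m (2 * (u * n + v)).+1 = view (D u v).2) ->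
  size (undets n (lo n m) (hi n m)) <= num_undetermined D.
Proof.
move=> Hm; rewrite /num_undetermined cardE.
rewrite -(size_map (fun p : 'I_n * 'I_n => val p.1 * n + val p.2)).
apply: uniq_leq_size; first exact: undets_uniq.
move=> p; rewrite mem_undets => /andP[pn]; have /andP[pd pm] := entry_div pn.
have pE : p = Ordinal pd * n + Ordinal pm by rewrite /= -divn_eq.
have [e1 e2] := Hm (Ordinal pd) (Ordinal pm); rewrite -pE in e1 e2.
rewrite /undet /hi /lo; case: ifP => // _ ne.
apply/mapP; exists (Ordinal pd, Ordinal pm) => //.
rewrite mem_enum inE; apply: contraNneq ne => /= e.
by rewrite e1 e2 e; lia.
Qed.

Lemma onth_catl (T : Type) (a b : seq T) i : i < size a -> onth (a ++ b) i = onth a i.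
Proof. by elim: a i => [|x a IH] [|i] //=; apply: IH. Qed.

Lemma onth_size (T : Type) (a : seq T) x : onth (rcons a x) (size a) = Some x.
Proof. by elim: a. Qed.

Definition tgr_ram : program := rcons (ccmd 31 0 tgr_prog) Halt.

(** Variables use registers up to 30, so temporaries start at 31; 100 exceeds the weight and, with
    slack, the code length of every expression. *)
Lemma tgr_cwf : cwf 31 100 tgr_prog.
Proof. by vm_compute. Qed.

Theorem theorem3p20 :
  exists (P : program) (C : nat), forall (n : nat) (D : 'M[int * int]_n),
    let k := num_undetermined D in
    decides_within P
      (C * (maxn k 1 ^ 2 * 3 ^ k * maxn n 1 ^ 4))
      (C * (2 ^ k + n ^ 2))
      ((2 ^ k + n ^ 2 + magnitude D).+1 ^ C)
      D.
Proof.
(* 200 is [2 * B], the machine steps per tick for [B = 100], and 300 exceeds 263. The same constant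
   is ample for the space and for the exponent of the word bound. *)
exists tgr_ram, (200 * 300) => n D k0.
have [C CE] : exists C, 200 * 300 = C by eexists.
rewrite CE.
pose m0 a := view (nth 0%R (input_words D) a).
have Hm (u v : 'I_n) : m0 (2 * (u * n + v)) = view (D u v).1 /\
    m0 (2 * (u * n + v)).+1 = view (D u v).2.
  by have [e1 e2] := input_words_nth D u v; rewrite /m0 e1 e2.
have kk0 := undets_le Hm; rewrite -/k0 in kk0.
set L := lo n m0 in kk0; set R := hi n m0 in kk0.
set k := size (undets n L R) in kk0.
have [X XE] : exists X, (2 ^ k0 + n ^ 2 + magnitude D).+1 = X by eexists.
rewrite XE.
have p0 : 0 < 2 ^ k0 by rewrite expn_gt0.
have X2 : 1 < X by rewrite -XE; clear -p0; lia.
have kp : k0 < 2 ^ k0 by apply: ltn_expl.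
have p2 : 2 ^ k <= 2 ^ k0 by rewrite leq_pexp2l.
(* [3 ^ k <= 4 ^ k] keeps the counter of codes polynomial in [2 ^ k]. *)
have p3 : 3 ^ k <= (2 ^ k0) ^ 2.
  rewrite -expnM mulnC expnM; apply: leq_trans (_ : 3 ^ k0 <= _); first by rewrite leq_pexp2l.
  by case: (k0) => // j; rewrite leq_exp2r.
have n2 : n ^ 2 = n * n by rewrite expnS expn1.
(* [V] has to dominate a constant multiple of [X * X]; as [X] is at least 2, eight further factors
   absorb 256. *)
have [V VE] : exists V, X ^ 10 = V by eexists.
have VX : 256 * (X * X) <= V.
  rewrite -VE (expnD X 8 2) (expnS X 1) expn1 leq_mul //.
  by apply: (@leq_trans (2 ^ 8)); rewrite // leq_exp2r.
have XX : X <= X * X by rewrite leq_pmulr //; clear -X2; lia.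
have mX a : m0 a <= X.
  rewrite /m0 -XE; have := input_words_le D a; rewrite /view.
  by case: (nth _ _ _) => // z; clear; lia.
have V_n : n * n + n + 10 <= V.
  have : n <= n * n by clear; case: n => // n'; rewrite leq_pmulr.
  by rewrite -XE in XX VX; rewrite -n2; clear -XX VX p0 => h; lia.
have V_k : 2 ^ k + 3 ^ k <= V.
  have h : (2 ^ k0) ^ 2 <= X * X.
    by rewrite expnS expn1; apply: leq_mul; rewrite -XE; clear; lia.
  have h' : 2 ^ k0 <= X by rewrite -XE; clear; lia.
  by clear -h h' p2 p3 VX XX; lia.
have V_m a : m0 a + 2 <= V by have := mX a; clear -VX XX X2; lia.
have V_t p : p < n * n -> L p + k <= V.
  move=> pn; have h : L p <= X + 2.
    by rewrite /L /lo; have := mX (2 * p); case: (diag n p); clear; lia.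
  have h' : k0 < X by rewrite -XE; clear -kp; lia.
  by clear -h h' kk0 VX XX X2; lia.
have [S SE] : exists S, C * (2 ^ k0 + n ^ 2) = S by eexists.
have S_n : 4 * (n * n) + 2 * 2 ^ k <= S.
  have h : 4 * (2 ^ k0 + n ^ 2) <= S by rewrite -SE leq_mul2r -CE orbT.
  by rewrite -n2; clear -h p2; lia.
rewrite SE.
pose s0 := State (fun r => if r == 0 then n else 0) m0 0.
have wp0 := @wp_tgr V S n m0 V_n V_k V_m S_n V_t s0 erefl (fun _ => erefl).
have V1 : 1 < V by clear -V_n; lia.
have VW : V <= V ^ 100 by rewrite -[X in X <= _]expn1 leq_exp2l.
(* The exponents multiply to 1000, well below [C]. *)
have WX : V ^ 100 <= X ^ C.
  by rewrite -VE -expnM leq_exp2l // -CE.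
have code : code_at tgr_ram 0 (ccmd 31 0 tgr_prog).
  apply: code_at_onth => i ih; rewrite add0n /tgr_ram -cats1 onth_catl //.
have bs0 : bounded 31 V s0.
  split=> [x _|a] /=; last by have := V_m a; clear; lia.
  by case: eqP => _ //; clear -V_n; lia.
have cs0 : corr 31 s0 (init D) by split=> [[|x] _|i].
have wb0 : words_bounded (V ^ 100) (init D).
  move=> i; split=> /=.
    by case: eqP => _ //=; apply: leq_trans VW; clear -V_n; lia.
  apply: leq_trans (input_words_le D i) _; apply: leq_trans VW.
  by clear -XE VX XX; lia.
have [t [c' [s' [r' pc' [[Q1 Q2] bs'] cs' k']]]] :=
  @ccmd_sound tgr_ram S V 100 31 V1 isT tgr_prog _ s0 (init D) tgr_cwf code bs0 cs0 wb0 wp0.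
have [run' wb' good'] := r'.
have halt : halted tgr_ram c'.
  rewrite /halted.
  have -> : pc c' = size (ccmd 31 0 tgr_prog) by rewrite size_ccmd pc'.
  exact: onth_size.
have wbX c : words_bounded (V ^ 100) c -> words_bounded (X ^ C) c.
  by move=> h i; have [h1 h2] := h i; split; apply: leq_trans WX.
exists t, c'; split=> //.
- have := total_cost_le kk0; move: Q2; rewrite -/k0.
  move: (maxn k0 1 ^ 2 * 3 ^ k0 * maxn n 1 ^ 4) => Z.
  by move: k'; rewrite -CE /=; clear; lia.
- have [Cr _] := cs'; rewrite Cr // Q1.
  have := TGR_realizes Hm; rewrite -/L -/R => TGR.
  have -> : `[< Ranged_Foremost_TGR D >] =
      all (consistent n m0) (iota 0 (n * n)) && `[< exists A, realizes n L R A >].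
    apply/asboolP/andP => [/TGR [H1 H2]|[/allP H1 /asboolP H2]].
      split; last exact/asboolP.
      by apply/allP => p; rewrite mem_iota => /andP[_ pn]; apply: H1.
    by apply/TGR; split=> // p pn; apply: H1; rewrite mem_iota.
  by case: (_ && _).
- move=> i c'' it ri; case: (ltnP i t) => [lt|ge].
    by have [h1 /wbX h2] := good' i c'' lt ri.
  have e : i = t by clear -it ge; lia.
  move: ri; rewrite e run' => -[<-]; split; last exact: wbX.
  by move=> a; rewrite /accesses halt.
Qed.
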